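(* Let $P=\prod_{j=1}^k(x\partial_x-r_j)$ with $r_1,\dots,r_k\in\mathbb{Q}$ (and $r_j\in R$), let $Q=\sum_{j\ge1}Q_jt^j\in t\cdot\mathrm{Diff}[[t]]$ with $Q_j\in\mathrm{Diff}=R[x^{\pm1},\partial_x]$ and $t$ a formal parameter, and let $D=P+Q$. Then for every $N\ge1$ there exists $C_N>0$ such that for all primes $p>C_N$ $$\det\big(\rho_{p,\xi,\eta}(D)\big)=(-1)^k\varepsilon^k\exp\Big(T_\varepsilon\,\mathrm{Coef}_{x^\varepsilon}\big(\rho_\varepsilon(\log(1+P^{-1}Q))x^\varepsilon\big)\Big)\Big|_{\varepsilon=-\xi^p\eta^p}\mod p,\ t^N .$$ Here $\log$ is understood as a power series, and $T_\varepsilon$ is applied to the coefficient of each power of $t$.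
   Context: Let $\mathbf{k}$ be a field of characteristic zero with algebraic closure $\bar{\mathbf{k}}$, and $R\subset\mathbf{k}$ a subring finitely generated over $\mathbb{Z}$ containing $r_1,\dots,r_k\in\mathbb{Q}$. $\mathrm{Diff}=R[x^{\pm1},\partial_x]$ is the ring of differential operators ($\partial_xx-x\partial_x=1$), and $$\overline{\mathrm{Diff}}=R[x^{\pm1},\partial_x,(x\partial_x-r_i+m)^{-1},\ 1\le i\le k,\ m\in\mathbb{Z}]$$ is obtained by adjoining two-sided inverses. For a large enough prime $p$ and formal parameters $\xi,\eta$, the $p$-dimensional representation $\rho_{p,\xi,\eta}$ of $\overline{\mathrm{Diff}}$ on $R/(p)(\xi,\eta)[x]/(x^p)$ is given by $\rho_{p,\xi,\eta}(x)=x+\xi$, $\rho_{p,\xi,\eta}(\partial_x)=\partial_x+\eta$ (the required inverses exist already over $R/(p)[\xi^{\pm1},\eta^{\pm1}]$). It is extended coefficientwise to power series in $t$. For a formal parameter $\varepsilon$, $\rho_\varepsilon$ is the representation of $\overline{\mathrm{Diff}}$ on the $\mathbf{k}(\varepsilon)$-vector space with basis $\{x^{\varepsilon+m}: m\in\mathbb{Z}\}$ given by $\rho_\varepsilon(x)x^{\varepsilon+m}=x^{\varepsilon+m+1}$, $\rho_\varepsilon(\partial_x)x^{\varepsilon+m}=(\varepsilon+m)x^{\varepsilon+m-1}$, extended coefficientwise to power series in $t$. $\mathrm{Coef}_{x^\varepsilon}$ is the coefficient of the basis vector $x^\varepsilon$. $T_\varepsilon:\bar{\mathbf{k}}(\varepsilon)\to\bar{\mathbf{k}}(\varepsilon)$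 is the $\bar{\mathbf{k}}$-linear operator (defined via partial fractions) with $T_\varepsilon(\varepsilon^i)=0$ for $i\ge0$ and $T_\varepsilon\big((\varepsilon-c)^{-j}\big)=\varepsilon^{-j}$ for $j>0$, $c\in\bar{\mathbf{k}}$; it preserves $\mathbf{k}(\varepsilon)$. ''mod $p$, $t^N$'': the equality is between power series in $t$ truncated modulo $t^N$; the coefficients of the right-hand side modulo $t^N$ lie in $R[1/m]$ for some integer $m\geq 1$ (depending on $N$) and are reduced modulo primes $p$ not dividing $m$. *)

(* Defs.v *)
From HB Require Import structures.
From mathcomp Require Import all_boot all_order all_algebra.
From mathcomp Require Import boolp.
From mathcomp Require Import finmap.
From mathcomp Require Import monalg.
From mathcomp Require Import ring.
Set Implicit Arguments.
Unset Strict Implicit.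
Unset Printing Implicit Defensive.
Import GRing.Theory.
Local Open Scope ring_scope.
Local Open Scope quotient_scope.

Section TwoSidedInverse.

Variable B : pzRingType.

Definition invertible (b : B) := exists c : B, b * c = 1 /\ c * b = 1.

Definition tsinv (b : B) : B :=
  if pselect (invertible b) is left h then projT1 (cid h) else 0.

Lemma tsinvP b : invertible b -> b * tsinv b = 1 /\ tsinv b * b = 1.
Proof. by move=> h; rewrite /tsinv; case: pselect => // h'; case: (cid _). Qed.

Lemma tsinv_uniq b c : b * c = 1 -> c * b = 1 -> tsinv b = c.
Proof.
move=> bc cb; have [|_ h] := tsinvP (b := b); first by exists c.
by rewrite -[LHS]mulr1 -bc mulrA h mul1r.
Qed.

End TwoSidedInverse.

Section FormalPowerSeries.

Variable B : pzRingType.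

Definition fps : Type := nat -> B.
HB.instance Definition _ := gen_eqMixin fps.
HB.instance Definition _ := gen_choiceMixin fps.

Implicit Types f g h : fps.

Definition fpsC (b : B) : fps := fun n => if n is 0 then b else 0.
Definition fps_opp f : fps := fun n => - f n.
Definition fps_add f g : fps := fun n => f n + g n.
Definition fps_mul f g : fps := fun n => \sum_(i < n.+1) f i * g (n - i)%N.

Lemma fps_addA : associative fps_add.
Proof. by move=> f g h; apply/funext => n; rewrite /fps_add addrA. Qed.

Lemma fps_addC : commutative fps_add.
Proof. by move=> f g; apply/funext => n; rewrite /fps_add addrC. Qed.

Lemma fps_add0 : left_id (fpsC 0) fps_add.
Proof. by move=> f; apply/funext => -[|n]; rewrite /fps_add /= add0r. Qed.

Lemma fps_addN : left_inverse (fpsC 0) fps_opp fps_add.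
Proof. by move=> f; apply/funext => -[|n]; rewrite /fps_add /fps_opp addNr. Qed.

Lemma fps_mul_rev f g n : fps_mul f g n = \sum_(i < n.+1) f (n - i)%N * g i.
Proof.
rewrite /fps_mul (reindex_inj rev_ord_inj) /=.
by apply: eq_bigr => i _; rewrite (sub_ordK i).
Qed.

Lemma fps_mulA : associative fps_mul.
Proof.
move=> f g h; apply/funext => i; rewrite [RHS]fps_mul_rev [LHS]/fps_mul.
pose c3 j k := f j * (g (i - j - k)%N * h k).
transitivity (\sum_(j < i.+1) \sum_(k < i.+1 | (k <= i - j)%N) c3 j k).
  apply: eq_bigr => /= j _; rewrite fps_mul_rev big_distrr /=.
  by rewrite (big_ord_narrow_leq (leq_subr _ _)).
rewrite (exchange_big_dep predT) //=; apply: eq_bigr => k _.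
transitivity (\sum_(j < i.+1 | (j <= i - k)%N) c3 j k).
  apply: eq_bigl => j; rewrite -ltnS -(ltnS j) -!subSn ?leq_ord //.
  by rewrite -subn_gt0 -(subn_gt0 j) -!subnDA addnC.
rewrite (big_ord_narrow_leq (leq_subr _ _)) /fps_mul big_distrl /=.
by apply: eq_bigr => j _; rewrite /c3 -!subnDA addnC mulrA.
Qed.

Lemma fps_mul1l : left_id (fpsC 1) fps_mul.
Proof.
move=> f; apply/funext => n; rewrite /fps_mul big_ord_recl /= mul1r subn0.
by rewrite big1 ?addr0 // => i _; rewrite mul0r.
Qed.

Lemma fps_mul1r : right_id (fpsC 1) fps_mul.
Proof.
move=> f; apply/funext => n; rewrite fps_mul_rev big_ord_recl /= mulr1 subn0.
by rewrite big1 ?addr0 // => i _; rewrite mulr0.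
Qed.

Lemma fps_mulDl : left_distributive fps_mul fps_add.
Proof.
move=> f g h; apply/funext => n; rewrite /fps_mul /fps_add -big_split /=.
by apply: eq_bigr => i _; rewrite mulrDl.
Qed.

Lemma fps_mulDr : right_distributive fps_mul fps_add.
Proof.
move=> f g h; apply/funext => n; rewrite /fps_mul /fps_add -big_split /=.
by apply: eq_bigr => i _; rewrite mulrDr.
Qed.

HB.instance Definition _ := GRing.isPzRing.Build fps
  fps_addA fps_addC fps_add0 fps_addN fps_mulA fps_mul1l fps_mul1r
  fps_mulDl fps_mulDr.

End FormalPowerSeries.

Section ComFormalPowerSeries.

Variable B : comPzRingType.

Lemma fps_mulC : commutative (@fps_mul B).
Proof.
move=> f g; apply/funext => n; rewrite fps_mul_rev.
by apply: eq_bigr => i _; rewrite mulrC.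
Qed.

HB.instance Definition _ :=
  GRing.PzRing_hasCommutativeMul.Build (fps B) fps_mulC.

End ComFormalPowerSeries.

Definition fps_map (B B' : pzRingType) (phi : B -> B') (f : fps B) : fps B' :=
  fun n => phi (f n).

(* log (1 + f), for f without constant term (so that f ^+ i only contributes
   to the coefficients of index at least i); c embeds the scalars in B *)
Definition fps_log1p (F : fieldType) (B : pzRingType) (c : F -> B)
    (f : fps B) : fps B :=
  fun n => \sum_(1 <= i < n.+1) c ((-1) ^+ i.+1 / i%:R) * (f ^+ i) n.

(* exp f, for f without constant term *)
Definition fps_exp (F : fieldType) (f : fps F) : fps F :=
  fun n => \sum_(0 <= i < n.+1) (i`!)%:R^-1 * (f ^+ i) n.

Definition fps_mx (B : pzRingType) n (M : fps 'M[B]_n) : 'M[fps B]_n :=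
  \matrix_(i, j) (fun l => M l i j).

(* The R-algebra generated by x, x^-1, d and (x d - r_i + m)^-1, presented by
   the relation d x - x d = 1 and the two-sided inverse relations. It is the
   quotient of formal expressions by the least congruence that contains these
   relations and the axioms of a ring with central scalars from R. *)
Section DiffbarPresentation.

Variables (R : comNzRingType) (n : nat) (r : 'I_n -> R).

Inductive dterm :=
| TC of R
| Tx
| Txi
| Td
| Tinv of 'I_n & int
| Tadd of dterm & dterm
| Tmul of dterm & dterm.

HB.instance Definition _ := gen_eqMixin dterm.
HB.instance Definition _ := gen_choiceMixin dterm.

Implicit Types (u v w : dterm) (a b : R) (i : 'I_n) (m : int).

Definition Ttheta i m := Tadd (Tmul Tx Td) (TC (m%:~R - r i)).

Inductive dcong : dterm -> dterm -> Prop :=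
| dcong_refl u : dcong u u
| dcong_sym u v : dcong u v -> dcong v u
| dcong_trans u v w : dcong u v -> dcong v w -> dcong u w
| dcong_add u u' v v' :
    dcong u u' -> dcong v v' -> dcong (Tadd u v) (Tadd u' v')
| dcong_mul u u' v v' :
    dcong u u' -> dcong v v' -> dcong (Tmul u v) (Tmul u' v')
| dcong_addA u v w : dcong (Tadd u (Tadd v w)) (Tadd (Tadd u v) w)
| dcong_addC u v : dcong (Tadd u v) (Tadd v u)
| dcong_add0 u : dcong (Tadd (TC 0) u) u
| dcong_addN u : dcong (Tadd (Tmul (TC (-1)) u) u) (TC 0)
| dcong_mulA u v w : dcong (Tmul u (Tmul v w)) (Tmul (Tmul u v) w)
| dcong_mul1l u : dcong (Tmul (TC 1) u) u
| dcong_mul1r u : dcong (Tmul u (TC 1)) u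
| dcong_mulDl u v w : dcong (Tmul (Tadd u v) w) (Tadd (Tmul u w) (Tmul v w))
| dcong_mulDr u v w : dcong (Tmul u (Tadd v w)) (Tadd (Tmul u v) (Tmul u w))
| dcong_CD a b : dcong (TC (a + b)) (Tadd (TC a) (TC b))
| dcong_CM a b : dcong (TC (a * b)) (Tmul (TC a) (TC b))
| dcong_Cc a u : dcong (Tmul (TC a) u) (Tmul u (TC a))
| dcong_xxi : dcong (Tmul Tx Txi) (TC 1)
| dcong_xix : dcong (Tmul Txi Tx) (TC 1)
| dcong_weyl : dcong (Tmul Td Tx) (Tadd (Tmul Tx Td) (TC 1))
| dcong_invr i m : dcong (Tmul (Ttheta i m) (Tinv i m)) (TC 1)
| dcong_invl i m : dcong (Tmul (Tinv i m) (Ttheta i m)) (TC 1).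

Definition dcongb u v : bool := `[< dcong u v >].

Lemma dcongb_refl : reflexive dcongb.
Proof. by move=> u; apply/asboolP; exact: dcong_refl. Qed.

Lemma dcongb_sym : symmetric dcongb.
Proof.
by move=> u v; apply/idP/idP => /asboolP h; apply/asboolP; exact: dcong_sym.
Qed.

Lemma dcongb_trans : transitive dcongb.
Proof.
move=> v u w /asboolP h1 /asboolP h2; apply/asboolP; exact: dcong_trans h1 h2.
Qed.

Canonical dcong_equiv := EquivRel dcongb dcongb_refl dcongb_sym dcongb_trans.

Definition Diffbar : Type := {eq_quot dcong_equiv}.

HB.instance Definition _ := Choice.on Diffbar.

Definition dclass (u : dterm) : Diffbar := \pi_({eq_quot dcong_equiv}) u.
Definition drepr (D : Diffbar) : dterm := @repr _ {eq_quot dcong_equiv} D.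

Lemma dreprK D : dclass (drepr D) = D.
Proof. exact: reprK. Qed.

Lemma dclassP u v : dclass u = dclass v <-> dcong u v.
Proof.
split=> [h|h]; last by apply/eqmodP/asboolP.
by apply/asboolP; move/eqmodP: h.
Qed.

Lemma dclassK u : dcong (drepr (dclass u)) u.
Proof. by apply/dclassP; rewrite dreprK. Qed.

Definition dconst (a : R) : Diffbar := dclass (TC a).
Definition dx : Diffbar := dclass Tx.
Definition dd : Diffbar := dclass Td.

Definition dadd (D E : Diffbar) := dclass (Tadd (drepr D) (drepr E)).
Definition dmul (D E : Diffbar) := dclass (Tmul (drepr D) (drepr E)).
Definition dopp (D : Diffbar) := dmul (dconst (-1)) D.

Lemma daddE u v : dadd (dclass u) (dclass v) = dclass (Tadd u v).
Proof. by apply/dclassP; apply: dcong_add; exact: dclassK. Qed.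

Lemma dmulE u v : dmul (dclass u) (dclass v) = dclass (Tmul u v).
Proof. by apply/dclassP; apply: dcong_mul; exact: dclassK. Qed.

Lemma daddA : associative dadd.
Proof.
move=> D E F; rewrite -[D]dreprK -[E]dreprK -[F]dreprK !(daddE, dmulE).
by apply/dclassP; exact: dcong_addA.
Qed.

Lemma daddC : commutative dadd.
Proof.
move=> D E; rewrite -[D]dreprK -[E]dreprK !(daddE, dmulE).
by apply/dclassP; exact: dcong_addC.
Qed.

Lemma dadd0 : left_id (dconst 0) dadd.
Proof.
by move=> D; rewrite -[D]dreprK !(daddE, dmulE); apply/dclassP; exact: dcong_add0.
Qed.

Lemma daddN : left_inverse (dconst 0) dopp dadd.
Proof.
move=> D; rewrite -[D]dreprK /dopp /dconst !(daddE, dmulE).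
by apply/dclassP; exact: dcong_addN.
Qed.

Lemma dmulA : associative dmul.
Proof.
move=> D E F; rewrite -[D]dreprK -[E]dreprK -[F]dreprK !(daddE, dmulE).
by apply/dclassP; exact: dcong_mulA.
Qed.

Lemma dmul1l : left_id (dconst 1) dmul.
Proof.
by move=> D; rewrite -[D]dreprK !(daddE, dmulE); apply/dclassP; exact: dcong_mul1l.
Qed.

Lemma dmul1r : right_id (dconst 1) dmul.
Proof.
by move=> D; rewrite -[D]dreprK !(daddE, dmulE); apply/dclassP; exact: dcong_mul1r.
Qed.

Lemma dmulDl : left_distributive dmul dadd.
Proof.
move=> D E F; rewrite -[D]dreprK -[E]dreprK -[F]dreprK !(daddE, dmulE).
by apply/dclassP; exact: dcong_mulDl.
Qed.

Lemma dmulDr : right_distributive dmul dadd.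
Proof.
move=> D E F; rewrite -[D]dreprK -[E]dreprK -[F]dreprK !(daddE, dmulE).
by apply/dclassP; exact: dcong_mulDr.
Qed.

HB.instance Definition _ := GRing.isPzRing.Build Diffbar
  daddA daddC dadd0 daddN dmulA dmul1l dmul1r dmulDl dmulDr.

Lemma dclassD u v : dclass (Tadd u v) = dclass u + dclass v.
Proof. by rewrite -daddE. Qed.

Lemma dclassM u v : dclass (Tmul u v) = dclass u * dclass v.
Proof. by rewrite -dmulE. Qed.

Lemma dconst_zmod : zmod_morphism dconst.
Proof.
have dconstD a b : dconst (a + b) = dconst a + dconst b.
  by rewrite -dclassD; apply/dclassP; exact: dcong_CD.
by move=> a b; apply/eqP; rewrite eq_sym subr_eq -dconstD subrK.
Qed.

Lemma dconst_monoid : monoid_morphism dconst.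
Proof.
by split=> // a b; rewrite -dclassM; apply/dclassP; exact: dcong_CM.
Qed.

HB.instance Definition _ := GRing.isZmodMorphism.Build R Diffbar dconst
  dconst_zmod.
HB.instance Definition _ := GRing.isMonoidMorphism.Build R Diffbar dconst
  dconst_monoid.

Lemma dconst_comm a (D : Diffbar) : dconst a * D = D * dconst a.
Proof.
by rewrite -[D]dreprK -!dclassM; apply/dclassP; exact: dcong_Cc.
Qed.

Lemma dweyl : dd * dx - dx * dd = 1.
Proof.
apply/eqP; rewrite subr_eq addrC -!dclassM -[1]/(dclass _) -dclassD.
by apply/eqP/dclassP; exact: dcong_weyl.
Qed.

Lemma dx_inv : invertible dx.
Proof.
exists (dclass Txi); rewrite -!dclassM; split; apply/dclassP.
  exact: dcong_xxi.
exact: dcong_xix.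
Qed.

Lemma dtheta_inv i m : invertible (dx * dd - dconst (r i) + m%:~R).
Proof.
exists (dclass (Tinv i m)).
have -> : dx * dd - dconst (r i) + m%:~R = dclass (Ttheta i m).
  by rewrite !(dclassD, dclassM) -/(dconst _) rmorphB /= rmorph_int -addrA
             [- _ + _]addrC.
rewrite -!dclassM; split; apply/dclassP.
  exact: dcong_invr.
exact: dcong_invl.
Qed.

Inductive in_Diff : Diffbar -> Prop :=
| in_Diff_const a : in_Diff (dconst a)
| in_Diff_x : in_Diff dx
| in_Diff_xinv : in_Diff (tsinv dx)
| in_Diff_d : in_Diff dd
| in_Diff_add D E : in_Diff D -> in_Diff E -> in_Diff (D + E)
| in_Diff_mul D E : in_Diff D -> in_Diff E -> in_Diff (D * E).

(* The ring morphism on Diffbar extending c on scalars and mapping x to X and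
   d to Y; the images of the remaining generators are then forced. *)
Section Representation.

Variables (B : pzRingType) (c : R -> B) (X Y : B).

Fixpoint deval (u : dterm) : B :=
  match u with
  | TC a => c a
  | Tx => X
  | Txi => tsinv X
  | Td => Y
  | Tinv i m => tsinv (X * Y - c (r i) + m%:~R)
  | Tadd u v => deval u + deval v
  | Tmul u v => deval u * deval v
  end.

Definition diffbar_rep (D : Diffbar) : B := deval (drepr D).

End Representation.

Record rep_axioms (B : pzRingType) (c : {rmorphism R -> B}) (X Y : B) : Prop :=
  RepAxioms {
    rep_central : forall a (b : B), c a * b = b * c a;
    rep_weyl : Y * X - X * Y = 1;
    rep_xinv : invertible X;
    rep_thetainv : forall i m, invertible (X * Y - c (r i) + m%:~R) }.

Section RepresentationTheory.

Variables (B : pzRingType) (c : {rmorphism R -> B}) (X Y : B).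
Hypothesis cXY : rep_axioms c X Y.

Lemma deval_cong u v : dcong u v -> deval c X Y u = deval c X Y v.
Proof.
have [cC cW cx ci] := cXY.
elim => //=.
- by move=> {}u {}v w _ -> _ ->.
- by move=> {}u u' {}v v' _ -> _ ->.
- by move=> {}u u' {}v v' _ -> _ ->.
- by move=> {}u {}v w; rewrite addrA.
- by move=> {}u {}v; rewrite addrC.
- by move=> {}u; rewrite rmorph0 add0r.
- by move=> {}u; rewrite rmorphN1 rmorph0 mulN1r addNr.
- by move=> {}u {}v w; rewrite mulrA.
- by move=> {}u; rewrite rmorph1 mul1r.
- by move=> {}u; rewrite rmorph1 mulr1.
- by move=> {}u {}v w; rewrite mulrDl.
- by move=> {}u {}v w; rewrite mulrDr.
- by move=> a b; rewrite rmorphD.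
- by move=> a b; rewrite rmorphM.
- by rewrite rmorph1; case: (tsinvP cx).
- by rewrite rmorph1; case: (tsinvP cx).
- by rewrite rmorph1 -cW addrC subrK.
- move=> i m; rewrite rmorphB /= rmorph_int rmorph1 [m%:~R - _]addrC addrA.
  by case: (tsinvP (ci i m)).
- move=> i m; rewrite rmorphB /= rmorph_int rmorph1 [m%:~R - _]addrC addrA.
  by case: (tsinvP (ci i m)).
Qed.

Lemma diffbar_rep_class u : diffbar_rep c X Y (dclass u) = deval c X Y u.
Proof. exact/deval_cong/dclassK. Qed.

Lemma diffbar_repC a : diffbar_rep c X Y (dconst a) = c a.
Proof. exact: diffbar_rep_class. Qed.

Lemma diffbar_rep_x : diffbar_rep c X Y dx = X.
Proof. exact: diffbar_rep_class. Qed.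

Lemma diffbar_rep_d : diffbar_rep c X Y dd = Y.
Proof. exact: diffbar_rep_class. Qed.

Lemma diffbar_repD D E :
  diffbar_rep c X Y (D + E) = diffbar_rep c X Y D + diffbar_rep c X Y E.
Proof.
by rewrite -[D]dreprK -[E]dreprK -dclassD !diffbar_rep_class.
Qed.

Lemma diffbar_rep_zmod : zmod_morphism (diffbar_rep c X Y).
Proof.
by move=> D E; apply/eqP; rewrite eq_sym subr_eq -diffbar_repD subrK.
Qed.

Lemma diffbar_rep_monoid : monoid_morphism (diffbar_rep c X Y).
Proof.
split=> [|D E]; first by rewrite -[1]/(dconst 1) diffbar_repC rmorph1.
by rewrite -[D]dreprK -[E]dreprK -dclassM !diffbar_rep_class.
Qed.

End RepresentationTheory.

End DiffbarPresentation.

Section LinearOperators.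

Variables (F : fieldType) (V : lmodType F).

Record linop := LinOp { linop_fun :> V -> V; linop_linear : linear linop_fun }.

HB.instance Definition _ := gen_eqMixin linop.
HB.instance Definition _ := gen_choiceMixin linop.

Lemma linopP (f g : linop) : f =1 g -> f = g.
Proof.
case: f g => [f hf] [g hg] /= /funext efg; case: _ / efg in hg *.
by congr LinOp; exact: Prop_irrelevance.
Qed.

Lemma scale_linop_subproof (a : F) : linear (fun v : V => a *: v).
Proof. by move=> b u v; rewrite scalerDr !scalerA mulrC. Qed.

Lemma opp_linop_subproof (f : linop) : linear (fun v => - f v).
Proof. by move=> b u v; rewrite linop_linear opprD scalerN. Qed.

Lemma add_linop_subproof (f g : linop) : linear (fun v => f v + g v).
Proof. by move=> b u v; rewrite !linop_linear scalerDr addrACA. Qed.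

Lemma comp_linop_subproof (f g : linop) : linear (fun v => f (g v)).
Proof. by move=> b u v; rewrite !linop_linear. Qed.

Definition scale_linop a := LinOp (scale_linop_subproof a).
Definition opp_linop f := LinOp (opp_linop_subproof f).
Definition add_linop f g := LinOp (add_linop_subproof f g).
Definition comp_linop f g := LinOp (comp_linop_subproof f g).

Lemma linop_zero (f : linop) : f 0 = 0.
Proof.
have := linop_linear f 1 0 0; rewrite !scale1r addr0 => /eqP.
by rewrite -[X in X == _]addr0 (inj_eq (addrI _)) => /eqP.
Qed.

Lemma linop_add (f : linop) u v : f (u + v) = f u + f v.
Proof. by have := linop_linear f 1 u v; rewrite !scale1r. Qed.

Lemma linop_scale (f : linop) a v : f (a *: v) = a *: f v.
Proof. by have := linop_linear f a v 0; rewrite linop_zero !addr0. Qed.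

Lemma add_linopA : associative add_linop.
Proof. by move=> f g h; apply/linopP => v /=; rewrite addrA. Qed.

Lemma add_linopC : commutative add_linop.
Proof. by move=> f g; apply/linopP => v /=; rewrite addrC. Qed.

Lemma add_linop0 : left_id (scale_linop 0) add_linop.
Proof. by move=> f; apply/linopP => v /=; rewrite scale0r add0r. Qed.

Lemma add_linopN : left_inverse (scale_linop 0) opp_linop add_linop.
Proof. by move=> f; apply/linopP => v /=; rewrite scale0r addNr. Qed.

Lemma comp_linopA : associative comp_linop.
Proof. by move=> f g h; apply/linopP. Qed.

Lemma comp_linop1l : left_id (scale_linop 1) comp_linop.
Proof. by move=> f; apply/linopP => v /=; rewrite scale1r. Qed.

Lemma comp_linop1r : right_id (scale_linop 1) comp_linop.
Proof. by move=> f; apply/linopP => v /=; rewrite scale1r. Qed.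

Lemma comp_linopDl : left_distributive comp_linop add_linop.
Proof. by move=> f g h; apply/linopP. Qed.

Lemma comp_linopDr : right_distributive comp_linop add_linop.
Proof. by move=> f g h; apply/linopP => v /=; rewrite linop_add. Qed.

HB.instance Definition _ := GRing.isPzRing.Build linop
  add_linopA add_linopC add_linop0 add_linopN comp_linopA comp_linop1l
  comp_linop1r comp_linopDl comp_linopDr.

Lemma scale_linop_zmod : zmod_morphism scale_linop.
Proof. by move=> a b; apply/linopP => v /=; rewrite scalerBl. Qed.

Lemma scale_linop_monoid : monoid_morphism scale_linop.
Proof. by split=> // a b; apply/linopP => v /=; rewrite scalerA. Qed.

HB.instance Definition _ := GRing.isZmodMorphism.Build F linop scale_linop
  scale_linop_zmod.
HB.instance Definition _ := GRing.isMonoidMorphism.Build F linop scale_linop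
  scale_linop_monoid.

End LinearOperators.

(* The total ring of fractions of B / (c): pairs a / s with s not a zero
   divisor modulo c. *)
Section FractionsModulo.

Variables (B : comNzRingType) (c : B).

Definition dvdc (a : B) := exists b, a = c * b.

Definition regular_mod (s : B) := forall a, dvdc (s * a) -> dvdc a.

Lemma regular_mod1 : regular_mod 1.
Proof. by move=> a; rewrite mul1r. Qed.

Lemma regular_modM s t : regular_mod s -> regular_mod t -> regular_mod (s * t).
Proof. by move=> hs ht a; rewrite -mulrA => /hs /ht. Qed.

Lemma dvdc0 : dvdc 0.
Proof. by exists 0; rewrite mulr0. Qed.

Lemma dvdcD a b : dvdc a -> dvdc b -> dvdc (a + b).
Proof. by move=> [u ->] [v ->]; exists (u + v); rewrite mulrDr. Qed.

Lemma dvdcMl a b : dvdc b -> dvdc (a * b).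
Proof. by move=> [u ->]; exists (a * u); rewrite mulrCA. Qed.

Record fracpair := FracPair { fnum : B; fden : B; fdenP : regular_mod fden }.

HB.instance Definition _ := gen_eqMixin fracpair.
HB.instance Definition _ := gen_choiceMixin fracpair.

Implicit Types x y z : fracpair.

Definition frac_eqb x y : bool := `[< dvdc (fnum x * fden y - fnum y * fden x) >].

Lemma frac_eqb_refl : reflexive frac_eqb.
Proof. by move=> x; apply/asboolP; rewrite subrr; exact: dvdc0. Qed.

Lemma frac_eqb_sym : symmetric frac_eqb.
Proof.
move=> x y; apply/idP/idP => /asboolP h; apply/asboolP; rewrite -opprB -mulN1r;
  exact: dvdcMl.
Qed.

Lemma frac_eqb_trans : transitive frac_eqb.
Proof.
move=> y x z /asboolP h1 /asboolP h2; apply/asboolP; apply: (fdenP (f := y)).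
have -> : fden y * (fnum x * fden z - fnum z * fden x) =
  fden z * (fnum x * fden y - fnum y * fden x)
  + fden x * (fnum y * fden z - fnum z * fden y) by ring.
by apply: dvdcD; exact: dvdcMl.
Qed.

Canonical frac_equiv :=
  EquivRel frac_eqb frac_eqb_refl frac_eqb_sym frac_eqb_trans.

Definition fracmod : Type := {eq_quot frac_equiv}.

HB.instance Definition _ := Choice.on fracmod.

Definition fclass x : fracmod := \pi_({eq_quot frac_equiv}) x.
Definition frepr (f : fracmod) : fracpair := @repr _ {eq_quot frac_equiv} f.

Lemma freprK f : fclass (frepr f) = f.
Proof. exact: reprK. Qed.

Lemma fclassP x y :
  fclass x = fclass y <-> dvdc (fnum x * fden y - fnum y * fden x).
Proof.
split=> [h|h]; last by apply/eqmodP/asboolP.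
by apply/asboolP; move/eqmodP: h.
Qed.

Lemma fclassK x :
  dvdc (fnum (frepr (fclass x)) * fden x - fnum x * fden (frepr (fclass x))).
Proof. by apply/fclassP; rewrite freprK. Qed.

Definition opp_pair x := FracPair (- fnum x) (fdenP (f := x)).
Definition add_pair x y :=
  FracPair (fnum x * fden y + fnum y * fden x)
           (regular_modM (fdenP (f := x)) (fdenP (f := y))).
Definition mul_pair x y :=
  FracPair (fnum x * fnum y)
           (regular_modM (fdenP (f := x)) (fdenP (f := y))).

Definition tofracmod (a : B) : fracmod := fclass (FracPair a regular_mod1).
Definition fopp (f : fracmod) : fracmod := fclass (opp_pair (frepr f)).
Definition fadd (f g : fracmod) : fracmod :=
  fclass (add_pair (frepr f) (frepr g)).
Definition fmul (f g : fracmod) : fracmod :=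
  fclass (mul_pair (frepr f) (frepr g)).

Lemma foppE x : fopp (fclass x) = fclass (opp_pair x).
Proof.
apply/fclassP => /=; have h := fclassK x; move: h; set y := frepr _ => h.
have -> : - fnum y * fden x - - fnum x * fden y =
  -1 * (fnum y * fden x - fnum x * fden y) by ring.
exact: dvdcMl.
Qed.

Lemma faddE x y : fadd (fclass x) (fclass y) = fclass (add_pair x y).
Proof.
apply/fclassP => /=; have := fclassK y; have := fclassK x.
set x' := frepr (fclass x); set y' := frepr (fclass y) => hx hy.
have -> : (fnum x' * fden y' + fnum y' * fden x') * (fden x * fden y) -
    (fnum x * fden y + fnum y * fden x) * (fden x' * fden y') =
  (fden y * fden y') * (fnum x' * fden x - fnum x * fden x')
  + (fden x * fden x') * (fnum y' * fden y - fnum y * fden y') by ring.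
by apply: dvdcD; exact: dvdcMl.
Qed.

Lemma fmulE x y : fmul (fclass x) (fclass y) = fclass (mul_pair x y).
Proof.
apply/fclassP => /=; have := fclassK y; have := fclassK x.
set x' := frepr (fclass x); set y' := frepr (fclass y) => hx hy.
have -> : (fnum x' * fnum y') * (fden x * fden y) -
    (fnum x * fnum y) * (fden x' * fden y') =
  (fnum y' * fden y) * (fnum x' * fden x - fnum x * fden x')
  + (fnum x * fden x') * (fnum y' * fden y - fnum y * fden y') by ring.
by apply: dvdcD; exact: dvdcMl.
Qed.

Lemma fclass_eq x y : fnum x * fden y = fnum y * fden x -> fclass x = fclass y.
Proof. by move=> h; apply/fclassP; rewrite h subrr; exact: dvdc0. Qed.

Lemma faddA : associative fadd.
Proof.
move=> f g h; rewrite -[f]freprK -[g]freprK -[h]freprK !faddE.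
by apply: fclass_eq => /=; ring.
Qed.

Lemma faddC : commutative fadd.
Proof.
move=> f g; rewrite -[f]freprK -[g]freprK !faddE.
by apply: fclass_eq => /=; ring.
Qed.

Lemma fadd0 : left_id (tofracmod 0) fadd.
Proof.
by move=> f; rewrite -[f]freprK faddE; apply: fclass_eq => /=; ring.
Qed.

Lemma faddN : left_inverse (tofracmod 0) fopp fadd.
Proof.
by move=> f; rewrite -[f]freprK foppE faddE; apply: fclass_eq => /=; ring.
Qed.

Lemma fmulA : associative fmul.
Proof.
move=> f g h; rewrite -[f]freprK -[g]freprK -[h]freprK !fmulE.
by apply: fclass_eq => /=; ring.
Qed.

Lemma fmulC : commutative fmul.
Proof.
move=> f g; rewrite -[f]freprK -[g]freprK !fmulE.
by apply: fclass_eq => /=; ring.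
Qed.

Lemma fmul1 : left_id (tofracmod 1) fmul.
Proof.
by move=> f; rewrite -[f]freprK fmulE; apply: fclass_eq => /=; ring.
Qed.

Lemma fmulDl : left_distributive fmul fadd.
Proof.
move=> f g h; rewrite -[f]freprK -[g]freprK -[h]freprK !(faddE, fmulE, faddE).
by apply: fclass_eq => /=; ring.
Qed.

Lemma fmul1r : right_id (tofracmod 1) fmul.
Proof. by move=> f; rewrite fmulC fmul1. Qed.

Lemma fmulDr : right_distributive fmul fadd.
Proof. by move=> f g h; rewrite fmulC fmulDl fmulC [fmul h f]fmulC. Qed.

HB.instance Definition _ := GRing.isPzRing.Build fracmod
  faddA faddC fadd0 faddN fmulA fmul1 fmul1r fmulDl fmulDr.
HB.instance Definition _ := GRing.PzRing_hasCommutativeMul.Build fracmod fmulC.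

Lemma tofracmod_zmod : zmod_morphism tofracmod.
Proof.
move=> a b; apply/esym; rewrite -[LHS]/(fadd _ (fopp _)) foppE faddE.
by apply: fclass_eq => /=; ring.
Qed.

Lemma tofracmod_monoid : monoid_morphism tofracmod.
Proof.
split=> // a b; apply/esym; rewrite -[LHS]/(fmul _ _) fmulE.
by apply: fclass_eq => /=; ring.
Qed.

HB.instance Definition _ := GRing.isZmodMorphism.Build B fracmod tofracmod
  tofracmod_zmod.
HB.instance Definition _ := GRing.isMonoidMorphism.Build B fracmod tofracmod
  tofracmod_monoid.

Lemma tofracmod_eq0 a : tofracmod a = 0 <-> dvdc a.
Proof.
by rewrite -[0]/(tofracmod 0); split=> [/fclassP|h];
   [|apply/fclassP]; rewrite /= mulr1 mul0r subr0.
Qed.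

Lemma tofracmod_unit s : regular_mod s -> exists f, tofracmod s * f = 1.
Proof.
move=> hs; exists (fclass (FracPair 1 hs)).
rewrite -[LHS]/(fmul _ _) fmulE; apply: fclass_eq => /=; ring.
Qed.

End FractionsModulo.

Section WeightedShift.

Variable F : fieldType.

Notation V := {malg F[int]}.

(* << m >> |-> a m times << m + s >> *)
Definition weighted_shift_fun (a : int -> F) (s : int) (v : V) : V :=
  \sum_(m <- msupp v) << a m * v@_m *g m + s >>.

Lemma weighted_shift_coef a s v l :
  (weighted_shift_fun a s v)@_l = a (l - s) * v@_(l - s).
Proof.
rewrite /weighted_shift_fun raddf_sum /=.
under eq_bigr do rewrite mcoeffU.
case: (msuppP v (l - s)) => h; last first.
  rewrite mulr0 big_seq big1 // => m hm.
  by case: eqP => // e; move: h; rewrite -e addrK hm.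
rewrite (bigD1_seq (l - s)) ?fset_uniq //= subrK eqxx mulr1n big1 ?addr0 //.
by move=> m /eqP hm; case: eqP => // e; case: hm; rewrite -e addrK.
Qed.

Lemma weighted_shift_linear a s : linear (weighted_shift_fun a s).
Proof.
move=> b u v; apply/malgP => l.
rewrite mcoeffD mcoeffZ !weighted_shift_coef mcoeffD mcoeffZ mulrDr.
by rewrite mulrCA.
Qed.

Definition weighted_shift a s : linop V := LinOp (weighted_shift_linear a s).

Lemma weighted_shiftU a s m : weighted_shift a s << m >> = << a m *g m + s >>.
Proof.
apply/malgP => l; rewrite weighted_shift_coef !mcoeffU.
rewrite -(inj_eq (addIr s)) subrK.
by case: eqP => [<-|_]; rewrite ?addrK /= ?mulr1n ?mulr1 ?mulr0n ?mulr0.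
Qed.

Lemma weighted_shift_mul a s b t :
  weighted_shift a s * weighted_shift b t =
  weighted_shift (fun m => a (m + t) * b m) (s + t).
Proof.
apply/linopP => v; apply/malgP => l; rewrite /= !weighted_shift_coef.
by rewrite mulrA opprD addrA subrK.
Qed.

Lemma weighted_shift_add a b s :
  weighted_shift a s + weighted_shift b s =
  weighted_shift (fun m => a m + b m) s.
Proof.
apply/linopP => v; apply/malgP => l.
by rewrite mcoeffD !weighted_shift_coef mulrDl.
Qed.

Lemma weighted_shift_opp a s :
  - weighted_shift a s = weighted_shift (fun m => - a m) s.
Proof.
apply/linopP => v; apply/malgP => l.
by rewrite mcoeffN !weighted_shift_coef mulNr.
Qed.

Lemma weighted_shift_const a : scale_linop V a = weighted_shift (fun=> a) 0.
Proof.
by apply/linopP => v; apply/malgP => l; rewrite mcoeffZ weighted_shift_coef subr0.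
Qed.

Lemma weighted_shift_eq a b s : a =1 b -> weighted_shift a s = weighted_shift b s.
Proof. by move/funext ->. Qed.

Lemma weighted_shift_axioms (R : comNzRingType) n (r : 'I_n -> R)
    (c : {rmorphism R -> F}) (e : F) :
    (forall a, e + c a != 0) ->
  rep_axioms r (scale_linop V \o c) (weighted_shift (fun=> 1) 1)
    (weighted_shift (fun m => e + m%:~R) (-1)).
Proof.
move=> he.
have one : 1 = weighted_shift (fun=> 1) 0 by rewrite -weighted_shift_const.
split.
- by move=> a b; apply/linopP => v /=; rewrite linop_scale.
- rewrite !weighted_shift_mul addNr addrN weighted_shift_opp weighted_shift_add.
  rewrite one; apply: weighted_shift_eq => m /=.
  by rewrite intrD; ring.
- exists (weighted_shift (fun=> 1) (-1)); rewrite !weighted_shift_mul addNr addrN.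
  by rewrite one; split; apply: weighted_shift_eq => m; rewrite mulr1.
- move=> i m.
  have -> : m%:~R = scale_linop V (c m%:~R) by rewrite !rmorph_int.
  rewrite /= !weighted_shift_const weighted_shift_mul addrN weighted_shift_opp.
  rewrite !weighted_shift_add.
  exists (weighted_shift (fun l => (e + c (l%:~R - r i + m%:~R))^-1) 0).
  have eE l : 1 * (e + l%:~R) - c (r i) + c m%:~R = e + c (l%:~R - r i + m%:~R).
    by rewrite mul1r rmorphD rmorphB /= rmorph_int !addrA.
  rewrite !weighted_shift_mul !addr0 one; split;
    apply: weighted_shift_eq => l /=; rewrite eE ?addr0 ?divff ?mulVf //.
Qed.

End WeightedShift.

Definition rat_fun_const (F : fieldType) (a : F) : {fraction {poly F}} :=
  tofrac a%:P.
Definition rat_fun_var (F : fieldType) : {fraction {poly F}} := tofrac 'X.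

HB.instance Definition _ (F : fieldType) :=
  GRing.RMorphism.copy (@rat_fun_const F) (@tofrac {poly F} \o polyC).

(* << m >> stands for the basis vector x^(eps + m) *)
Section RepresentationEps.

Variables (k : fieldType) (n : nat) (r : 'I_n -> k).

Notation kE := {fraction {poly k}}.
Notation V := {malg kE[int]}.

Definition rho_eps : Diffbar r -> linop V :=
  diffbar_rep (scale_linop V \o @rat_fun_const k)
    (weighted_shift (fun=> 1) 1)
    (weighted_shift (fun m => rat_fun_var k + m%:~R) (-1)).

Lemma rho_eps_axioms :
  rep_axioms r (scale_linop V \o @rat_fun_const k)
    (weighted_shift (fun=> 1) 1)
    (weighted_shift (fun m => rat_fun_var k + m%:~R) (-1)).
Proof.
apply: weighted_shift_axioms => a.
by rewrite /rat_fun_var /rat_fun_const -rmorphD /= tofrac_eq0 -size_poly_eq0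
           size_XaddC.
Qed.

HB.instance Definition _ := GRing.isZmodMorphism.Build (Diffbar r) (linop V)
  rho_eps (diffbar_rep_zmod rho_eps_axioms).
HB.instance Definition _ := GRing.isMonoidMorphism.Build (Diffbar r) (linop V)
  rho_eps (diffbar_rep_monoid rho_eps_axioms).

Lemma rho_eps_const a v : rho_eps (dconst r a) v = rat_fun_const a *: v.
Proof. by rewrite /rho_eps diffbar_repC //; exact: rho_eps_axioms. Qed.

Lemma rho_eps_x m : rho_eps (dx r) << m >> = << m + 1 >>.
Proof.
by rewrite /rho_eps diffbar_rep_x ?weighted_shiftU //; exact: rho_eps_axioms.
Qed.

Lemma rho_eps_d m :
  rho_eps (dd r) << m >> = << rat_fun_var k + m%:~R *g m - 1 >>.
Proof.
by rewrite /rho_eps diffbar_rep_d ?weighted_shiftU //; exact: rho_eps_axioms.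
Qed.

End RepresentationEps.

Section ExtensionOfScalars.

Variables (R R' : comNzRingType) (iota : {rmorphism R -> R'}).
Variables (n : nat) (r : 'I_n -> R).

Notation r' := (fun i => iota (r i)).

Definition diffbar_ext : Diffbar r -> Diffbar r' :=
  diffbar_rep (dconst r' \o iota) (dx r') (dd r').

Lemma diffbar_ext_axioms :
  rep_axioms r (dconst r' \o iota) (dx r') (dd r').
Proof.
split=> [a b|||i m].
- exact: dconst_comm.
- exact: dweyl.
- exact: dx_inv.
- exact: (dtheta_inv r').
Qed.

HB.instance Definition _ := GRing.isZmodMorphism.Build (Diffbar r) (Diffbar r')
  diffbar_ext (diffbar_rep_zmod diffbar_ext_axioms).
HB.instance Definition _ :=
  GRing.isMonoidMorphism.Build (Diffbar r) (Diffbar r')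
    diffbar_ext (diffbar_rep_monoid diffbar_ext_axioms).

End ExtensionOfScalars.

Section WeylProducts.

Variables (M : pzRingType) (X Y : M).
Hypothesis weyl : Y * X - X * Y = 1.

Lemma prod_comm_factor (f : nat -> M) m j :
    (forall i i', f i * f i' = f i' * f i) -> (j < m)%N ->
  exists W, \prod_(i < m) f i = f j * W /\ \prod_(i < m) f i = W * f j.
Proof.
move=> fC; elim: m => // m IH; rewrite ltnS leq_eqVlt big_ord_recr /=.
case/orP => [/eqP ->|/IH [W [e1 e2]]].
  exists (\prod_(i < m) f i); split=> //.
  by apply/esym/commr_prod => i _; exact: fC.
exists (W * f m); split; first by rewrite e1 mulrA.
by rewrite {1}e2 -!mulrA fC.
Qed.

Lemma weyl_falling m :
  X ^+ m * Y ^+ m = \prod_(i < m) (X * Y - i%:R).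
Proof.
elim: m => [|m IH]; first by rewrite big_ord0 mulr1.
rewrite exprS exprSr mulrA -[X * _ * _]mulrA IH.
have shift k : X * \prod_(i < k) (X * Y - i%:R) =
    (\prod_(i < k) (X * Y - i.+1%:R)) * X.
  elim: k => [|k IHk]; first by rewrite !big_ord0 mulr1 mul1r.
  rewrite !big_ord_recr /= mulrA IHk -!mulrA; congr (_ * _).
  have e : X * (X * Y) = X * Y * X - X.
    have /eqP := weyl; rewrite subr_eq => /eqP e.
    by rewrite -[X * Y * X]mulrA e mulrDr mulr1 addrC addKr.
  by rewrite mulrBr mulrBl e (commr_nat X) -natr1 mulrDl mul1r
             [_ * X + X]addrC opprD addrA.
rewrite shift -mulrA big_ord_recl /= subr0.
apply/esym/commr_prod => i _; apply: commrB; first by [].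
exact: commr_nat.
Qed.

Lemma invertible_factor (a b u v : M) :
    a * b = u -> b * a = u -> u * v = 1 -> v * u = 1 -> (forall w, v * w = w * v) ->
  invertible a.
Proof.
move=> ab ba uv vu vC; exists (b * v); split; first by rewrite mulrA ab.
by rewrite -vC -mulrA ba.
Qed.

Lemma frobenius_comm p (a b : M) :
    prime p -> p%:R = 0 :> M -> GRing.comm a b ->
  (a + b) ^+ p = a ^+ p + b ^+ p.
Proof.
move=> pp p0 cab; rewrite exprDn_comm //.
case: p pp p0 => // p pp p0.
rewrite big_ord_recl big_ord_recr /= subn0 expr0 mulr1 bin0 subnn mul1r binn.
rewrite big1 ?add0r // => i _.
have /dvdnP [q ->] : (p.+1 %| 'C(p.+1, bump 0 i))%N.
  by apply: prime_dvd_bin => //=; exact: ltn_ord.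
by rewrite mulrnA -mulr_natr p0 mulr0.
Qed.

End WeylProducts.

(* Matrices act on columns of coordinates in the basis 1, x, .., x^(p-1) of the
   quotient by x^p. *)
Section MatrixRepresentation.

Variables (A : comPzRingType) (p : nat) (xi eta : A).

Definition mulx_mx : 'M[A]_p := \matrix_(i, j) (i == j.+1 :> nat)%:R.
Definition derx_mx : 'M[A]_p := \matrix_(i, j) (j%:R *+ (i.+1 == j :> nat)).

Definition mx_x : 'M[A]_p := mulx_mx + xi%:M.
Definition mx_d : 'M[A]_p := derx_mx + eta%:M.

Lemma mulx_mx_nil m (i j : 'I_p) : (i < j + m)%N -> (mulx_mx ^+ m) i j = 0.
Proof.
elim: m i j => [|m IH] i j.
  by rewrite addn0 mxE => h; case: eqP => // e; rewrite e ltnn in h.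
rewrite exprS mxE addnS ltnS => h; rewrite big1 // => l _; rewrite mxE.
case: eqP => [e|_]; last by rewrite mul0r.
by rewrite IH ?mulr0 // -e.
Qed.

Lemma derx_mx_nil m (i j : 'I_p) : (j < i + m)%N -> (derx_mx ^+ m) i j = 0.
Proof.
elim: m i j => [|m IH] i j.
  by rewrite addn0 mxE => h; case: eqP => // e; rewrite e ltnn in h.
rewrite exprS mxE => h; rewrite big1 // => l _; rewrite mxE.
case: eqP => [e|_]; last by rewrite mulr0n mul0r.
by rewrite IH ?mulr0 // -e addSnnS.
Qed.

Lemma derx_mulx : p%:R = 0 :> A -> derx_mx * mulx_mx - mulx_mx * derx_mx = 1.
Proof.
move=> p0; apply/matrixP => i j; rewrite !mxE.
have -> : \sum_l derx_mx i l * mulx_mx l j = j.+1%:R *+ (i == j).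
  have [h|h] := ltnP i.+1 p.
    rewrite (bigD1 (Ordinal h)) //= !mxE /= eqxx eqSS big1.
      by rewrite addr0 -(inj_eq val_inj) /=; case: eqP => [->|_];
         rewrite ?mulr1 ?mulr0.
    move=> l; rewrite -(inj_eq val_inj) /= !mxE [(_ == val l)]eq_sym.
    by move/negbTE => ->; rewrite mul0r.
  rewrite big1 => [|l _]; last first.
    rewrite !mxE; case: eqP => [e|_]; last by rewrite mul0r.
    by move: (ltn_ord l); rewrite -e ltnNge h.
  case: eqP => [<-|//]; suff -> : i.+1 = p by rewrite p0.
  by apply/eqP; rewrite eqn_leq h andbT.
have -> : \sum_l mulx_mx i l * derx_mx l j = j%:R *+ (i == j).
  case: j => -[|j] hj /=.
    rewrite mul0rn big1 // => l _; rewrite !mxE /=; case: (_ == _.+1);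
      by rewrite ?mulr0n ?mul0rn ?mulr0 ?mul0r.
  rewrite (bigD1 (Ordinal (ltnW hj))) //= !mxE /= eqxx mulr1n big1.
    by rewrite addr0 -(inj_eq val_inj) /=; case: eqP; rewrite ?mul1r ?mul0r.
  move=> l; rewrite -(inj_eq val_inj) /= !mxE /= eqSS => /negbTE ->.
  by rewrite mulr0n mulr0.
by rewrite -mulrnBl -natr1 addrAC subrr add0r.
Qed.

Lemma mx_weyl : p%:R = 0 :> A -> mx_d * mx_x - mx_x * mx_d = 1.
Proof.
move=> p0; rewrite /mx_x /mx_d !mulrDl !mulrDr -[RHS](derx_mulx p0).
have cE (a : A) (N : 'M[A]_p) : a%:M * N = N * a%:M by exact: comm_scalar_mx.
rewrite !(cE _ mulx_mx) !(cE _ derx_mx) (cE xi eta%:M).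
rewrite -[X in X - _]addrA -[X in _ - X]addrA [X in _ - (_ + X)]addrCA opprD.
by rewrite addrACA subrr addr0.
Qed.

Hypotheses (pp : prime p) (p0 : p%:R = 0 :> A).
Variables (xi' eta' : A).
Hypotheses (xiK : xi * xi' = 1) (etaK : eta * eta' = 1).

Lemma scalar_mxMr (a b : A) : (a * b)%:M = a%:M * b%:M :> 'M[A]_p.
Proof. exact: scalar_mxM. Qed.

Lemma scalar_mxX (a : A) m : a%:M ^+ m = (a ^+ m)%:M :> 'M[A]_p.
Proof. by elim: m => // m IH; rewrite !exprS IH -scalar_mxMr. Qed.

Lemma mx_p0 : p%:R = 0 :> 'M[A]_p.
Proof. by rewrite -[p%:R]/(1%:M *+ p) -raddfMn p0 raddf0. Qed.

Lemma mx_xp : mx_x ^+ p = (xi ^+ p)%:M.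
Proof.
rewrite frobenius_comm //; last 2 first.
- exact: mx_p0.
- by apply/esym; exact: comm_scalar_mx.
rewrite scalar_mxX (_ : mulx_mx ^+ p = 0) ?add0r //.
by apply/matrixP => i j; rewrite mulx_mx_nil ?mxE // ltn_addl.
Qed.

Lemma mx_dp : mx_d ^+ p = (eta ^+ p)%:M.
Proof.
rewrite frobenius_comm //; last 2 first.
- exact: mx_p0.
- by apply/esym; exact: comm_scalar_mx.
rewrite scalar_mxX (_ : derx_mx ^+ p = 0) ?add0r //.
by apply/matrixP => i j; rewrite derx_mx_nil ?mxE // ltn_addl.
Qed.

Lemma mx_xinv : invertible mx_x.
Proof.
have p_gt0 := prime_gt0 pp.
have xip : xi ^+ p * xi' ^+ p = 1 by rewrite -exprMn xiK expr1n.
apply: (@invertible_factor _ _ (mx_x ^+ p.-1) (mx_x ^+ p) (xi' ^+ p)%:M).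
- by rewrite -exprS prednK.
- by rewrite -exprSr prednK.
- by rewrite mx_xp -scalar_mxMr xip.
- by rewrite mx_xp -scalar_mxMr mulrC xip.
- by move=> w; exact: comm_scalar_mx.
Qed.

Lemma mx_theta_inv (z : int) : invertible (mx_x * mx_d - z%:~R).
Proof.
have p_gt0 := prime_gt0 pp.
pose j := `|(z %% p)%Z|%N.
have pn0 : p%:Z != 0 by rewrite eqz_nat -lt0n.
have hj : j%:Z = (z %% p)%Z by rewrite /j gez0_abs // modz_ge0.
have jp : (j < p)%N by rewrite -ltz_nat hj ltz_pmod.
have -> : z%:~R = j%:R :> 'M[A]_p.
  rewrite {1}(divz_eq z p) -hj intrD intrM -!pmulrn.
  by rewrite mx_p0 mulr0 add0r.
have e : (mx_x ^+ p * mx_d ^+ p) * (xi' ^+ p * eta' ^+ p)%:M = 1.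
  rewrite mx_xp mx_dp -!scalar_mxMr mulrACA -!exprMn xiK etaK.
  by rewrite mulr1 expr1n.
have [|W [e1 e2]] := @prod_comm_factor _ (fun i => mx_x * mx_d - i%:R) p j _ jp.
  move=> i i' /=; rewrite !mulrBl !mulrBr -!natrM mulnC !(commr_nat (mx_x * mx_d)).
  by rewrite !opprB addrACA [X in _ + X]addrC addrACA.
rewrite -(weyl_falling (mx_weyl p0)) in e1 e2.
apply: (invertible_factor (esym e1) (esym e2) e).
- by rewrite -[LHS](comm_mx_scalar _ _).
- by move=> w; exact: comm_scalar_mx.
Qed.

Lemma mx_rep_axioms (R : comNzRingType) n (r : 'I_n -> R)
    (c : {rmorphism R -> 'M[A]_p}) :
    (forall a b, c a * b = b * c a) ->
    (forall i, exists z : int, c (r i) = z%:~R) ->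
  rep_axioms r c mx_x mx_d.
Proof.
move=> cC cr; split=> //; first exact: mx_weyl.
  exact: mx_xinv.
move=> i m; have [z ->] := cr i.
have -> : mx_x * mx_d - z%:~R + m%:~R = mx_x * mx_d - (z - m)%:~R.
  by rewrite rmorphB /= opprB addrA addrAC.
exact: mx_theta_inv.
Qed.

End MatrixRepresentation.

Section MatrixConst.

Variables (R : comNzRingType) (A : comPzRingType) (c : {rmorphism R -> A}).
Variable p : nat.

Definition mx_const (a : R) : 'M[A]_p := (c a)%:M.

Lemma mx_const_zmod : zmod_morphism mx_const.
Proof. by move=> a b; rewrite /mx_const !rmorphB. Qed.

Lemma mx_const_monoid : monoid_morphism mx_const.
Proof.
by split=> [|a b]; rewrite /mx_const ?rmorph1 // rmorphM; exact: scalar_mxM.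
Qed.

HB.instance Definition _ :=
  GRing.isZmodMorphism.Build R 'M[A]_p mx_const mx_const_zmod.
HB.instance Definition _ :=
  GRing.isMonoidMorphism.Build R 'M[A]_p mx_const mx_const_monoid.

End MatrixConst.

Lemma drop_polyMX (R : nzSemiRingType) (q : {poly R}) : drop_poly 1 (q * 'X) = q.
Proof. exact: (drop_polyMXn_id 1 q). Qed.

Section RepresentationModP.

Variables (R : comNzRingType) (p : nat).

(* R/(p)(xi, eta), with xi = 'X%:P and eta = 'X; since R/(p) need not be a
   domain, this is the total ring of fractions of R/(p)[xi, eta]. *)
Definition modp_frac : Type := fracmod (p%:R : {poly {poly R}}).
HB.instance Definition _ := GRing.ComPzRing.on modp_frac.

Definition to_modp_frac (f : {poly {poly R}}) : modp_frac :=
  tofracmod (p%:R : {poly {poly R}}) f.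
HB.instance Definition _ := GRing.RMorphism.copy to_modp_frac
  (tofracmod (p%:R : {poly {poly R}})).

Definition modp_const (a : R) : modp_frac := to_modp_frac a%:P%:P.
HB.instance Definition _ := GRing.RMorphism.copy modp_const
  (to_modp_frac \o (polyC \o polyC)).

Definition modp_xi : modp_frac := to_modp_frac 'X%:P.
Definition modp_eta : modp_frac := to_modp_frac 'X.

Definition rho_p n (r : 'I_n -> R) : Diffbar r -> 'M[modp_frac]_p :=
  diffbar_rep (mx_const modp_const p) (mx_x p modp_xi) (mx_d p modp_eta).

Lemma modp_frac_p0 : p%:R = 0 :> modp_frac.
Proof.
rewrite -(rmorph_nat to_modp_frac); apply/tofracmod_eq0.
by exists 1; rewrite mulr1.
Qed.

Lemma regular_xi : regular_mod (p%:R : {poly {poly R}}) 'X%:P.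
Proof.
move=> a [b]; rewrite mulr_natl => e; exists (map_poly (drop_poly 1) b).
rewrite mulr_natl; apply/polyP => i.
have /(congr1 (fun q : {poly {poly R}} => drop_poly 1 q`_i)) := e.
rewrite coefCM mulrC drop_polyMX => ->.
by rewrite !coefMn raddfMn coef_map.
Qed.

Lemma regular_eta : regular_mod (p%:R : {poly {poly R}}) 'X.
Proof.
move=> a [b]; rewrite mulr_natl => e; exists (drop_poly 1 b).
by rewrite mulr_natl -[LHS]drop_polyMX mulrC e raddfMn.
Qed.

Lemma modp_xi_unit : exists xi', modp_xi * xi' = 1.
Proof. exact: tofracmod_unit regular_xi. Qed.

Lemma modp_eta_unit : exists eta', modp_eta * eta' = 1.
Proof. exact: tofracmod_unit regular_eta. Qed.

Variables (n : nat) (r : 'I_n -> R) (a b : 'I_n -> int).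
Hypotheses (ab : forall i, coprimez (a i) (b i)).
Hypotheses (rab : forall i, (b i)%:~R * r i = (a i)%:~R).
Hypothesis pp : prime p.

Lemma modp_const_int i : exists z : int, modp_const (r i) = z%:~R.
Proof.
have /(congr1 modp_const) := rab i; rewrite rmorphM !rmorph_int.
set rho := modp_const (r i) => e.
have p0 : p%:~R = 0 :> modp_frac := modp_frac_p0.
have [pb|pb] := boolP (p%:Z %| b i)%Z.
  have b0 : (b i)%:~R = 0 :> modp_frac.
    by have /dvdzP [q ->] := pb; rewrite intrM p0 mulr0.
  have /eqP := ab i; case: (Bezoutz (a i) (b i)) => u [v <-].
  move/(congr1 (fun z : int => z%:~R : modp_frac)).
  rewrite intrD !intrM -e b0 mul0r !mulr0 addr0 => one.
  by exists 0; rewrite -[rho]mulr1 -[1]/(1%:~R) -one mulr0.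
have /eqP : coprimez p%:Z (b i) by rewrite coprimezE prime_coprime.
case: (Bezoutz p%:Z (b i)) => u [v <-].
move/(congr1 (fun z : int => z%:~R : modp_frac)).
rewrite intrD !intrM p0 mulr0 add0r => one.
by exists (v * a i); rewrite intrM -e mulrA one mul1r.
Qed.

Lemma rho_p_axioms :
  rep_axioms r (mx_const modp_const p) (mx_x p modp_xi) (mx_d p modp_eta).
Proof.
have [xi' xiK] := modp_xi_unit; have [eta' etaK] := modp_eta_unit.
apply: (mx_rep_axioms pp modp_frac_p0 xiK etaK).
  by move=> u v; exact: comm_scalar_mx.
move=> i; have [z e] := modp_const_int i; exists z.
by rewrite -[LHS]/((modp_const (r i))%:M) e rmorph_int.
Qed.

End RepresentationModP.

(* A triple (c, j, a) stands for the fraction a / (eps - c) ^ (j + 1). *)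
Section PartialFractions.

Variables (K E : fieldType) (iota : {rmorphism {poly K} -> E}).
Hypothesis iota_inj : injective iota.

Notation cst a := (iota a%:P).
Notation x := (iota 'X).

Definition pf_sum (q : {poly K}) (s : seq (K * nat * K)) : E :=
  iota q + \sum_(t <- s) cst t.2 / (x - cst t.1.1) ^+ t.1.2.+1.

Definition pf_shift (s : seq (K * nat * K)) : E :=
  \sum_(t <- s) cst t.2 / x ^+ t.1.2.+1.

Lemma pf_lin_neq0 c : x - cst c != 0.
Proof. by rewrite -rmorphB /= -(rmorph0 iota) (inj_eq iota_inj) polyXsubC_eq0. Qed.

Definition regular_at c (f : E) :=
  exists a b : {poly K}, b.[c] != 0 /\ f * iota b = iota a.

Lemma regular_at_poly c q : regular_at c (iota q).
Proof. by exists q, 1; rewrite hornerC oner_neq0 rmorph1 mulr1. Qed.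

Lemma regular_atD c f g : regular_at c f -> regular_at c g -> regular_at c (f + g).
Proof.
move=> [a [b [b0 e]]] [a' [b' [b'0 e']]]; exists (a * b' + a' * b), (b * b').
by rewrite hornerM mulf_neq0 //; split=> //; rewrite rmorphD !rmorphM /= -e -e'; ring.
Qed.

Lemma regular_atN c f : regular_at c f -> regular_at c (- f).
Proof.
by move=> [a [b [b0 e]]]; exists (- a), b; split=> //; rewrite mulNr e rmorphN.
Qed.

Lemma regular_at_pole c c' a n :
  c' != c -> regular_at c (cst a / (x - cst c') ^+ n).
Proof.
move=> cc'; exists a%:P, (('X - c'%:P) ^+ n); split.
  by rewrite horner_exp !hornerE expf_neq0 // subr_eq0 eq_sym.
by rewrite rmorphXn rmorphB /= divfK // expf_neq0 // pf_lin_neq0.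
Qed.

Lemma regular_at_principal c (F : {poly K}) :
    F`_0 = 0 ->
    regular_at c (\sum_(i < size F) cst F`_i / (x - cst c) ^+ i) ->
  F = 0.
Proof.
move=> F0 [a [b [b0 e]]]; apply: contraTeq isT => Fn0.
set d := (size F).-1.
have sF : size F = d.+1 by rewrite prednK // size_poly_gt0.
have d_gt0 : (0 < d)%N.
  rewrite lt0n; apply: contraNneq Fn0 => d0.
  by rewrite -lead_coef_eq0 lead_coefE -/d d0 F0.
pose G := \sum_(i < size F) F`_i *: ('X - c%:P) ^+ (d - i).
have eG : iota G = (x - cst c) ^+ d * \sum_(i < size F) cst F`_i / (x - cst c) ^+ i.
  rewrite rmorph_sum mulr_sumr; apply: eq_bigr => i _ /=.
  rewrite -mul_polyC rmorphM rmorphXn rmorphB /= mulrCA; congr (_ * _).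
  have id : (i <= d)%N by rewrite -ltnS -sF.
  by rewrite -{2}(subnK id) exprD mulfK // expf_neq0 // pf_lin_neq0.
have Gc : G.[c] = lead_coef F.
  rewrite horner_sum sF big_ord_recr /= subnn expr0 hornerZ hornerC mulr1.
  rewrite big1 ?add0r ?lead_coefE // => i _.
  by rewrite hornerZ horner_exp !hornerE subrr expr0n subn_eq0 leqNgt ltn_ord mulr0.
have /iota_inj : iota (G * b) = iota (('X - c%:P) ^+ d * a).
  by rewrite !rmorphM /= eG -mulrA e rmorphXn rmorphB.
move/(congr1 (horner^~ c)); rewrite !hornerM Gc horner_exp !hornerE subrr.
rewrite expr0n eqn0Ngt d_gt0 mul0r => /eqP.
by rewrite mulf_eq0 (negbTE b0) orbF lead_coef_eq0 (negbTE Fn0).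
Qed.

Lemma pf_sum_eq0 q s : pf_sum q s = 0 -> pf_shift s = 0.
Proof.
move=> e.
pose C := undup (map (fun t => t.1.1) s).
pose m := (\max_(t <- s) t.1.2.+1).+1.
pose F c := \poly_(i < m) \sum_(t <- s | (t.1.1 == c) && (t.1.2.+1 == i)) t.2.
have split_sum (z : K -> E) :
    \sum_(t <- s) cst t.2 / z t.1.1 ^+ t.1.2.+1 =
    \sum_(c <- C) \sum_(i < size (F c)) cst (F c)`_i / z c ^+ i.
  transitivity (\sum_(c <- C) \sum_(i < m) cst (F c)`_i / z c ^+ i); last first.
    apply: eq_bigr => c _.
    have sm : (size (F c) <= m)%N by exact: size_poly.
    rewrite (big_ord_widen m (fun i => cst (F c)`_i / z c ^+ i) sm).
    rewrite [RHS]big_mkcond /=; apply: eq_bigr => i _.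
    by case: ltnP => // h; rewrite nth_default // polyC0 rmorph0 mul0r.
  transitivity (\sum_(c <- C) \sum_(t <- s | t.1.1 == c)
                  cst t.2 / z t.1.1 ^+ t.1.2.+1).
    rewrite (exchange_big_dep predT) //= big_seq [RHS]big_seq.
    apply: eq_bigr => t ts.
    have tC : t.1.1 \in C.
      by rewrite mem_undup; apply/mapP; exists t.
    rewrite -big_filter (_ : filter _ _ = [:: t.1.1]) ?big_seq1 //.
    rewrite -(filter_pred1_uniq (undup_uniq _) tC).
    by apply: eq_filter => c; rewrite /= eq_sym.
  apply: eq_bigr => c _.
  transitivity (\sum_(i < m) \sum_(t <- s | (t.1.1 == c) && (t.1.2.+1 == i))
                  cst t.2 / z t.1.1 ^+ t.1.2.+1).
    rewrite (exchange_big_dep (fun t => t.1.1 == c)) /=; last first.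
      by move=> i t _ /andP[].
    rewrite big_seq_cond [RHS]big_seq_cond; apply: eq_bigr => t /andP[ts tc].
    have tm : (t.1.2.+1 < m)%N by rewrite ltnS; exact: leq_bigmax_seq.
    rewrite (big_pred1 (Ordinal tm)) // => i.
    by rewrite /= tc eq_sym.
  apply: eq_bigr => i _.
  rewrite coef_poly ltn_ord (raddf_sum polyC) raddf_sum mulr_suml /=.
  by apply: eq_bigr => t /andP[/eqP -> /eqP ->].
have F0 c : F c = 0.
  apply: (@regular_at_principal c).
    by rewrite coef_poly /= big1 // => t; rewrite andbF.
  have [cC|cC] := boolP (c \in C); last first.
    rewrite (_ : F c = 0); first by rewrite size_poly0 big_ord0 -(rmorph0 iota);
      exact: regular_at_poly.
    apply/polyP => i; rewrite coef_poly coef0; case: ifP => // _.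
    rewrite big_seq_cond big1 // => t /andP[ts /andP[/eqP tc _]].
    by case/negP: cC; rewrite mem_undup; apply/mapP; exists t.
  have := e; rewrite /pf_sum (split_sum (fun c => x - cst c)).
  rewrite (bigD1_seq c) ?undup_uniq //= addrCA => /eqP.
  rewrite addr_eq0 => /eqP ->.
  apply: regular_atN; apply: regular_atD; first exact: regular_at_poly.
  elim/big_ind: _ => [||c' cc'].
  - by rewrite -(rmorph0 iota); exact: regular_at_poly.
  - by move=> f g; exact: regular_atD.
  elim/big_ind: _ => [||i _].
  - by rewrite -(rmorph0 iota); exact: regular_at_poly.
  - by move=> f g; exact: regular_atD.
  exact: regular_at_pole.
rewrite /pf_shift (split_sum (fun=> x)) big1 // => c _.
by rewrite F0 size_poly0 big_ord0.
Qed.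

Lemma pf_sum_lin a q s q' s' :
  cst a * pf_sum q s + pf_sum q' s' =
  pf_sum (a%:P * q + q') ([seq (t.1, a * t.2) | t <- s] ++ s').
Proof.
rewrite /pf_sum mulrDr addrACA rmorphD rmorphM; congr (_ + _).
rewrite big_cat big_map mulr_sumr /=; congr (_ + _).
by apply: eq_bigr => t _; rewrite mulrA polyCM rmorphM.
Qed.

Lemma pf_shift_lin a s s' :
  cst a * pf_shift s + pf_shift s' =
  pf_shift ([seq (t.1, a * t.2) | t <- s] ++ s').
Proof.
rewrite /pf_shift big_cat big_map mulr_sumr /=; congr (_ + _).
by apply: eq_bigr => t _; rewrite mulrA polyCM rmorphM.
Qed.

Lemma pf_sum_inj q s q' s' :
  pf_sum q s = pf_sum q' s' -> pf_shift s = pf_shift s'.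
Proof.
move=> e.
have e0 : cst (-1) * pf_sum q' s' + pf_sum q s = 0.
  by rewrite e polyCN polyC1 rmorphN1 mulN1r addNr.
rewrite pf_sum_lin in e0; have := pf_sum_eq0 e0.
rewrite -pf_shift_lin polyCN polyC1 rmorphN1 mulN1r addrC => /eqP.
by rewrite subr_eq0 => /eqP.
Qed.

Definition has_pf (f : E) := exists s q, f = pf_sum q s.

Lemma has_pf_lin a f g : has_pf f -> has_pf g -> has_pf (cst a * f + g).
Proof.
by move=> [s [q ->]] [s' [q' ->]]; rewrite pf_sum_lin; do 2 eexists.
Qed.

Lemma has_pf_poly q : has_pf (iota q).
Proof. by exists [::], q; rewrite /pf_sum big_nil addr0. Qed.

Lemma has_pf0 : has_pf 0.
Proof. by rewrite -(rmorph0 iota); exact: has_pf_poly. Qed.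

Lemma has_pfD f g : has_pf f -> has_pf g -> has_pf (f + g).
Proof. by move=> hf /(has_pf_lin 1 hf); rewrite polyC1 !rmorph1 mul1r. Qed.

Lemma has_pfZ a f : has_pf f -> has_pf (cst a * f).
Proof. by move=> hf; have := has_pf_lin a hf has_pf0; rewrite addr0. Qed.

Lemma has_pf_pole c n : has_pf ((x - cst c) ^- n.+1).
Proof.
by exists [:: (c, n, 1)], 0;
   rewrite /pf_sum big_seq1 /= rmorph0 add0r polyC1 !rmorph1 mul1r.
Qed.

Lemma has_pf_div_lin c f : has_pf f -> has_pf (f / (x - cst c)).
Proof.
move=> [s [q ->]]; rewrite /pf_sum mulrDl; apply: has_pfD.
  have /factor_theorem [q' e] : root (q - q.[c]%:P) c.
    by rewrite /root !hornerE subrr.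
  rewrite -[q](subrK q.[c]%:P) e rmorphD rmorphM rmorphB /= mulrDl.
  rewrite mulfK ?pf_lin_neq0 //.
  apply: has_pfD; first exact: has_pf_poly.
  by apply: has_pfZ; rewrite -[_ - _]expr1; exact: has_pf_pole.
rewrite mulr_suml; elim/big_ind: _ => [||[[c' j] a] _ /=].
- exact: has_pf0.
- by move=> f' g; exact: has_pfD.
rewrite -mulrA -invfM [_ ^+ _ * _]mulrC; apply: has_pfZ.
have [<-|cc'] := eqVneq c c'; first by rewrite -exprS; exact: has_pf_pole.
elim: {j}j.+1 => [|j IH].
  by rewrite expr0 mulr1 -[_ - _]expr1; exact: has_pf_pole.
have -> : ((x - cst c) * (x - cst c') ^+ j.+1)^-1 =
    cst (c - c')^-1 * (((x - cst c) * (x - cst c') ^+ j)^-1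
                       + cst (-1) * (x - cst c') ^- j.+1).
  have ne : c - c' != 0 by rewrite subr_eq0.
  have cB : cst (c - c') = cst c - cst c' by rewrite polyCB rmorphB.
  have h : cst c - cst c' != 0.
    by rewrite -cB -(rmorph0 iota) (inj_eq iota_inj) polyC_eq0.
  have -> : cst (c - c')^-1 = (cst c - cst c')^-1.
    apply: (mulIf h).
    by rewrite [RHS]mulVf // -cB -rmorphM -polyCM mulVf // polyC1 rmorph1.
  have h1 := pf_lin_neq0 c; have h2 := pf_lin_neq0 c'.
  have h3 : (x - cst c') ^+ j != 0 by rewrite expf_neq0.
  rewrite polyCN !polyC1 !rmorphN1 exprS; move: h3; set y := (_ ^+ j) => h3.
  field; rewrite h1 h2 h3 h //.
apply: has_pfZ; apply: has_pfD => //; apply: has_pfZ; exact: has_pf_pole.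
Qed.

End PartialFractions.

Section FractionNumDen.

Variable D : idomainType.
Implicit Types f : {fraction D}.

Definition frac_num f : D := \n_(repr f).
Definition frac_den f : D := \d_(repr f).

Lemma frac_den_neq0 f : tofrac (frac_den f) != 0.
Proof. by rewrite tofrac_eq0; exact: denom_ratioP. Qed.

Lemma frac_numdenE f : f = tofrac (frac_num f) / tofrac (frac_den f).
Proof.
apply: (mulIf (frac_den_neq0 f)); rewrite divfK ?frac_den_neq0 //.
rewrite /frac_num /frac_den -{1}[f]reprK; set u := repr f.
have u0 := denom_ratioP u.
rewrite !piE; apply/eqmodP; rewrite /= FracField.equivfE /FracField.mulf.
by rewrite !numden_Ratio ?oner_eq0 ?mulr1 ?mulf_neq0 ?oner_neq0 //= mulrC.
Qed.

End FractionNumDen.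

(* The extension k(eps) -> kb(eps) of a field embedding k -> kb. *)
Section RatFunMap.

Variables (k kb : fieldType) (j : {rmorphism k -> kb}).

Definition rat_fun_map (f : {fraction {poly k}}) : {fraction {poly kb}} :=
  tofrac (map_poly j (frac_num f)) / tofrac (map_poly j (frac_den f)).

Lemma rat_fun_mapE a b : b != 0 ->
  rat_fun_map (tofrac a / tofrac b) =
  tofrac (map_poly j a) / tofrac (map_poly j b).
Proof.
move=> b0; rewrite /rat_fun_map; set f := tofrac a / tofrac b.
have b0' : tofrac b != 0 by rewrite tofrac_eq0.
have nz c : tofrac c != 0 -> tofrac (map_poly j c) != 0.
  by rewrite !tofrac_eq0 map_poly_eq0.
apply/eqP; rewrite eqr_div ?nz ?frac_den_neq0 //; apply/eqP.
rewrite -!rmorphM /=; congr (tofrac (map_poly j _)).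
apply/eqP; rewrite -tofrac_eq !rmorphM /= -eqr_div ?frac_den_neq0 //.
by rewrite -frac_numdenE.
Qed.

Lemma rat_fun_map_tofrac a : rat_fun_map (tofrac a) = tofrac (map_poly j a).
Proof.
have := rat_fun_mapE a (oner_neq0 _).
by rewrite !(rmorph1, divr1).
Qed.

Lemma rat_fun_map_zmod : zmod_morphism rat_fun_map.
Proof.
move=> f g; rewrite [f]frac_numdenE [g]frac_numdenE.
set a := frac_num f; set b := frac_den f.
set c := frac_num g; set d := frac_den g.
have b0 : b != 0 by rewrite -tofrac_eq0 frac_den_neq0.
have d0 : d != 0 by rewrite -tofrac_eq0 frac_den_neq0.
have bdE (x y x' y' : {poly k}) : y != 0 -> y' != 0 ->
    tofrac x / tofrac y - tofrac x' / tofrac y' =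
    tofrac (x * y' - x' * y) / tofrac (y * y').
  move=> y0 y0'; rewrite -mulNr addf_div ?tofrac_eq0 //.
  by rewrite rmorphB !rmorphM /= mulNr.
rewrite bdE // !rat_fun_mapE ?mulf_neq0 //.
rewrite -[in RHS]mulNr addf_div ?tofrac_eq0 ?map_poly_eq0 //.
by rewrite !(rmorphB, rmorphM) /= mulNr.
Qed.

Lemma rat_fun_map_monoid : monoid_morphism rat_fun_map.
Proof.
split=> [|f g]; first by rewrite -(rmorph1 (@tofrac {poly k})) rat_fun_map_tofrac !rmorph1.
rewrite [f]frac_numdenE [g]frac_numdenE.
set a := frac_num f; set b := frac_den f.
set c := frac_num g; set d := frac_den g.
have b0 : b != 0 by rewrite -tofrac_eq0 frac_den_neq0.
have d0 : d != 0 by rewrite -tofrac_eq0 frac_den_neq0.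
rewrite mulf_div -!rmorphM !rat_fun_mapE ?mulf_neq0 // mulf_div.
by rewrite !rmorphM.
Qed.

HB.instance Definition _ := GRing.isZmodMorphism.Build {fraction {poly k}}
  {fraction {poly kb}} rat_fun_map rat_fun_map_zmod.
HB.instance Definition _ := GRing.isMonoidMorphism.Build {fraction {poly k}}
  {fraction {poly kb}} rat_fun_map rat_fun_map_monoid.

End RatFunMap.

Section TruncationEps.

Variable K : closedFieldType.

Notation KE := {fraction {poly K}}.
Notation iota := (@tofrac {poly K}).

Lemma tofrac_inj : injective iota.
Proof. by move=> a b /eqP; rewrite tofrac_eq => /eqP. Qed.

Lemma has_pf_all (f : KE) : has_pf iota f.
Proof.
rewrite [f]frac_numdenE; set a := frac_num f; set b := frac_den f.
have b0 : b != 0 by rewrite -tofrac_eq0 frac_den_neq0.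
have [s ->] := closed_field_poly_normal b.
rewrite -mul_polyC rmorphM /= invfM mulrCA.
have -> : (iota (lead_coef b)%:P)^-1 = iota (lead_coef b)^-1%:P.
  apply: (mulIf (x := iota (lead_coef b)%:P)).
    by rewrite tofrac_eq0 polyC_eq0 lead_coef_eq0.
  rewrite mulVf ?tofrac_eq0 ?polyC_eq0 ?lead_coef_eq0 //.
  by rewrite -rmorphM -polyCM mulVf ?lead_coef_eq0 // polyC1 rmorph1.
apply: has_pfZ; elim: s => [|z s IH].
  by rewrite big_nil rmorph1 divr1; exact: has_pf_poly.
rewrite big_cons [('X - _) * _]mulrC rmorphM invfM mulrA rmorphB /=.
exact: (has_pf_div_lin tofrac_inj).
Qed.

(* Independent of the chosen decomposition, see T_epsE. *)
Definition T_eps (f : KE) : KE := pf_shift iota (projT1 (cid (has_pf_all f))).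

Lemma T_epsE q s : T_eps (pf_sum iota q s) = pf_shift iota s.
Proof.
rewrite /T_eps; case: (cid _) => s' [q' e] /=.
exact/esym/(pf_sum_inj tofrac_inj e).
Qed.

Lemma T_eps_linear a f g :
  T_eps (rat_fun_const a * f + g) = rat_fun_const a * T_eps f + T_eps g.
Proof.
have [s [q ->]] := has_pf_all f; have [s' [q' ->]] := has_pf_all g.
by rewrite pf_sum_lin !T_epsE pf_shift_lin.
Qed.

Lemma T_eps_poly i : T_eps (rat_fun_var K ^+ i) = 0.
Proof.
have -> : rat_fun_var K ^+ i = pf_sum iota ('X^i) [::].
  by rewrite /pf_sum big_nil addr0 rmorphXn.
by rewrite T_epsE /pf_shift big_nil.
Qed.

Lemma T_eps_pole c j : (0 < j)%N ->
  T_eps ((rat_fun_var K - rat_fun_const c) ^- j) = rat_fun_var K ^- j.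
Proof.
case: j => // j _.
have -> : (rat_fun_var K - rat_fun_const c) ^- j.+1 =
    pf_sum iota 0 [:: (c, j, 1)].
  by rewrite /pf_sum big_seq1 rmorph0 add0r /= polyC1 rmorph1 mul1r.
by rewrite T_epsE /pf_shift big_seq1 /= polyC1 rmorph1 mul1r.
Qed.

End TruncationEps.
Lemma invertibleM (B : pzRingType) (a b : B) :
  invertible a -> invertible b -> invertible (a * b).
Proof.
move=> [a' [aa' a'a]] [b' [bb' b'b]]; exists (b' * a'); split.
  by rewrite mulrA -(mulrA a) bb' mulr1.
by rewrite mulrA -(mulrA b') a'a mulr1.
Qed.

Section LeadingTerm.

Variables (R : comNzRingType) (n : nat) (r : 'I_n -> R).

Definition euler_prod : Diffbar r :=
  \prod_(i < n) (dx r * dd r - dconst r (r i)).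

Lemma euler_prod_inv : invertible euler_prod.
Proof.
rewrite /euler_prod; elim/big_ind: _ => [||i _].
- by exists 1; rewrite mulr1.
- exact: invertibleM.
- by have := dtheta_inv r i 0; rewrite addr0.
Qed.

End LeadingTerm.

Definition fin_gen_ring (R : nzRingType) :=
  exists s : seq R, forall P : R -> Prop,
    P 1 -> (forall a b, P a -> P b -> P (a - b)) ->
    (forall a b, P a -> P b -> P (a * b)) ->
    (forall a, a \in s -> P a) -> forall a, P a.

(* alpha in R/(p)(xi, eta) is the reduction modulo p (p not dividing m) of the
   value at eps = - xi^p eta^p of g, a Laurent polynomial in eps with
   coefficients in R[1/m]: clearing denominators, m^s eps^e g is a polynomial G
   over R, and m and - xi^p eta^p are invertible in R/(p)(xi, eta). *)
Definition reduction_at (R : comNzRingType) (F : fieldType)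
    (iota : {rmorphism R -> F}) (m p : nat)
    (g : {fraction {poly F}}) (alpha : modp_frac R p) : Prop :=
  let eps_p := - (modp_xi R p ^+ p * modp_eta R p ^+ p) in
  exists (s e : nat) (G : {poly R}),
    m%:R ^+ s * rat_fun_var F ^+ e * g = tofrac (map_poly iota G) /\
    m%:R ^+ s * eps_p ^+ e * alpha =
      \sum_(i < size G) modp_const p G`_i * eps_p ^+ i.

Arguments diffbar_ext {R R'} iota {n} r _.
Arguments rho_eps {k n} r _.
Arguments rho_p {R} p {n} r _.

(* Main.v *)
From HB Require Import structures.
Require Import Defs.
From mathcomp Require Import all_boot all_order all_algebra.
From mathcomp Require Import finfield.
From mathcomp Require Import boolp.
From mathcomp Require Import finmap monalg.
From mathcomp Require Import ring.

Set Implicit Arguments.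
Unset Strict Implicit.
Unset Printing Implicit Defensive.

Import GRing.Theory.
Local Open Scope ring_scope.

(* Dividing by det rho_p(P) = (xi^p eta^p)^n, the claim becomes
   log det(1 + F) = tr log(1 + F) for F = P^-1 Q, together with the fact that
   the trace of rho_p(D) is the reduction modulo p of T_eps Coef rho_eps(D) at
   eps = - xi^p eta^p, for every single D in Diffbar. The latter is linear in D,
   and up to integer denominators Diffbar is spanned by the x^s theta^i and the
   x^s (theta - c)^-j, where theta = x d and c is in r_i + Z. For s <> 0 both
   sides vanish, as [theta, D] = s D. For s = 0, conjugation by x shifts theta
   by 1, so tr theta^i = 0 for i < p - 1 and c may be taken to be 0; then
   theta^p - theta = xi^p eta^p expresses tr theta^-j recursively. Instead of
   dividing by integers modulo p, the determinant (by Jacobi's formula) and the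
   exponential are compared through their common differential equation. *)

(** * Traces in representations of the Weyl algebra *)

Section Fermat.

Variables (M : pzRingType) (T : M).

(** Integer coefficients act on any ring, commutative or not, and they can be reduced modulo $p$ to
    compare polynomials over $\mathbb{F}_p$. *)
Definition int_horner (q : {poly int}) : M := \sum_(k < size q) T ^+ k *~ q`_k.

Lemma int_horner_wide m (q : {poly int}) : (size q <= m)%N ->
  int_horner q = \sum_(k < m) T ^+ k *~ q`_k.
Proof.
move=> h; rewrite /int_horner (big_ord_widen m (fun k => T ^+ k *~ q`_k) h).
rewrite [LHS]big_mkcond /=; apply: eq_bigr => i _.
by case: ltnP => // hi; rewrite nth_default.
Qed.

Lemma int_hornerB (q q' : {poly int}) :
  int_horner (q - q') = int_horner q - int_horner q'.
Proof.
pose m := maxn (size (q - q')) (maxn (size q) (size q')).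
rewrite !(@int_horner_wide m) ?leq_max ?leqnn ?orbT // -sumrB.
by apply: eq_bigr => i _; rewrite coefB mulrzBr.
Qed.

Lemma int_hornerXn m : int_horner 'X^m = T ^+ m.
Proof.
rewrite /int_horner size_polyXn big_ord_recr /= coefXn eqxx big1 ?add0r // => i
  _.
by rewrite coefXn ltn_eqF.
Qed.

Lemma int_horner_mul_lin (q : {poly int}) (i : int) :
  int_horner (q * ('X - i%:P)) = int_horner q * (T - i%:~R).
Proof.
rewrite mulrBr int_hornerB mulrBr; congr (_ - _).
  rewrite (@int_horner_wide (size q).+1) ?size_mulX_leq //; last first.
    by rewrite (leq_trans (size_polyMleq _ _)) // size_polyX addn2.
  rewrite big_ord_recl coefMX /= mulr0z add0r mulr_suml; apply: eq_bigr => k _.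
  by rewrite coefMX /= mulrzAl -exprSr.
rewrite mulrC mul_polyC (@int_horner_wide (size q)) ?size_scale_leq //.
rewrite mulr_suml; apply: eq_bigr => k _.
by rewrite coefZ mulrzr -mulrzA mulrC.
Qed.

(** As $p=0$ in [M], it suffices that $p$ divides every coefficient of $\prod_{i<p}(X-i)-(X^p-X)$
    over the integers; over $\mathbb{F}_p$ both terms are the product of all $X-a$. *)
Lemma falling_charp p (pp : prime p) (p0 : p%:R = 0 :> M) :
  \prod_(i < p) (T - i%:R) = T ^+ p - T.
Proof.
pose q : {poly int} := \prod_(i < p) ('X - (i%:Z)%:P).
have -> : \prod_(i < p) (T - i%:R) = int_horner q.
  rewrite /q; elim: p {pp p0 q} => [|m IH].
    by rewrite !big_ord0 -(expr0 'X) int_hornerXn.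
  by rewrite !big_ord_recr /= int_horner_mul_lin IH.
apply/eqP; rewrite -subr_eq0 -(int_hornerXn p) -[in X in _ - (_ - X)](expr1 T).
rewrite -int_hornerXn -!int_hornerB expr1; apply/eqP.
rewrite /int_horner big1 // => i _; rewrite -mulrzr.
suff /dvdzP [z ->] : (p %| (q - ('X^p - 'X))`_i)%Z.
  by rewrite intrM -(pmulrn 1 p) p0 !mulr0.
rewrite (dvdz_pcharf (pchar_Fp pp)) -(coef_map (intr : int -> 'F_p)).
rewrite !rmorphB /= map_polyXn map_polyX rmorph_prod /=.
have -> : 'X^p - 'X = \prod_(x : 'F_p) ('X - x%:P) :> {poly 'F_p}.
  by rewrite -finField_genPoly card_Fp.
have -> : \prod_(i < p) map_poly intr ('X - (i%:Z)%:P) =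
    \prod_(x : 'F_p) ('X - x%:P) :> {poly 'F_p}; last first.
  by rewrite subrr coef0.
under [RHS]eq_bigr do rewrite -[X in X%:P]natr_Zp.
under [LHS]eq_bigr do rewrite map_polyXsubC /= -pmulrn.
rewrite -(big_mkord xpredT (fun i => 'X - (i%:R : 'F_p)%:P)).
by rewrite -[in RHS](big_mkord xpredT (fun i => 'X - (i%:R : 'F_p)%:P)) Fp_cast.
Qed.

End Fermat.

(** Bezout gives an inverse of [n] modulo [p]; [A] is not assumed to be a domain. *)
Lemma natr_cancel (A : comPzRingType) p (p0 : p%:R = 0 :> A) (pp : prime p) n
  (a : A) :
  (0 < n < p)%N -> n%:R * a = 0 -> a = 0.
Proof.
move=> /andP[n0 np] na.
have /coprimeP -/(_ n0) [[u v] /= uv] : coprime n p.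
  by rewrite coprime_sym prime_coprime // gtnNdvd.
have /(congr1 (fun i => i%:R : A)) : (u * n = v * p + 1)%N.
  by rewrite -uv subnKC // ltnW // -subn_gt0 uv.
rewrite natrD !natrM p0 mulr0 add0r mulr1n => un.
by rewrite -[a]mul1r -un -mulrA na mulr0.
Qed.

Section WeylTraces.

Variables (A : comPzRingType) (p : nat).
Hypotheses (pp : prime p) (p0 : p%:R = 0 :> A).

Lemma tr_mulC (M N : 'M[A]_p) : \tr (M * N) = \tr (N * M).
Proof. exact: mxtrace_mulC. Qed.

Variables (X Y : 'M[A]_p).
Hypothesis weyl : Y * X - X * Y = 1.

Lemma weylE : Y * X = X * Y + 1.
Proof. by rewrite -weyl addrC subrK. Qed.

Lemma weylXn a : Y * X ^+ a = X ^+ a * Y + X ^+ a.-1 *+ a.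
Proof.
elim: a => [|a IH]; first by rewrite mulr1 mul1r addr0.
rewrite exprSr mulrA IH mulrDl -mulrA weylE mulrDr mulr1 mulrA -addrA.
congr (_ + _); rewrite mulrnAl; case: a {IH} => [|a] /=; first by rewrite addr0.
by rewrite -exprSr -mulrS.
Qed.

Lemma weylYn b : Y ^+ b * X = X * Y ^+ b + Y ^+ b.-1 *+ b.
Proof.
elim: b => [|b IH]; first by rewrite mulr1 mul1r addr0.
rewrite exprS -mulrA IH mulrDr mulrA weylE mulrDl mul1r -addrA mulrA.
congr (_ + _); rewrite mulrnAr; case: b {IH} => [|b] /=; first by rewrite addr0.
by rewrite -exprS -mulrS.
Qed.

(** Since $(a+1)X^a=[Y,X^{a+1}]$ and $Y$ commutes with $Y^b$, the multiple $(a+1)X^aY^b$ is a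
    commutator, and $a+1$ cancels modulo $p$. *)
Lemma tr_normal_l a b : (a.+1 < p)%N -> \tr (X ^+ a * Y ^+ b) = 0.
Proof.
move=> ap; apply: (natr_cancel p0 pp (n := a.+1)) => //.
rewrite mulr_natl -raddfMn /= -mulrnAl.
have -> : X ^+ a *+ a.+1 = Y * X ^+ a.+1 - X ^+ a.+1 * Y.
  by rewrite weylXn addrC addKr.
by rewrite mulrBl raddfB /= -mulrA tr_mulC -!mulrA -exprSr -exprS subrr.
Qed.

(** The mirror argument, from $(b+1)Y^b=[Y^{b+1},X]$. *)
Lemma tr_normal_r a b : (b.+1 < p)%N -> \tr (X ^+ a * Y ^+ b) = 0.
Proof.
move=> bp; apply: (natr_cancel p0 pp (n := b.+1)) => //.
rewrite mulr_natl -raddfMn /= -mulrnAr.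
have -> : Y ^+ b *+ b.+1 = Y ^+ b.+1 * X - X * Y ^+ b.+1.
  by rewrite weylYn addrC addKr.
by rewrite mulrBr raddfB /= mulrA tr_mulC !mulrA -exprS -exprSr subrr.
Qed.

Lemma euler_normal a : X * Y * (X ^+ a * Y ^+ a) =
  X ^+ a.+1 * Y ^+ a.+1 + X ^+ a * Y ^+ a *+ a.
Proof.
rewrite -!mulrA (mulrA Y) weylXn mulrDl mulrDr mulrA mulrA -exprS -mulrA -exprS.
congr (_ + _); case: a => [|a]; first by rewrite !mulr0n mul0r mulr0.
by rewrite mulrnAl mulrnAr mulrA -exprS.
Qed.

(** In the binomial expansion every term but the first has $X$ to a power below $p-1$, hence is
    traceless. This serves to remove the parameter $\xi$. *)
Lemma tr_shift_l c :
  \tr ((X + c%:M) ^+ p.-1 * Y ^+ p.-1) = \tr (X ^+ p.-1 * Y ^+ p.-1).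
Proof.
rewrite exprDn_comm; last by apply/esym; exact: comm_scalar_mx.
rewrite big_ord_recl expr0 mulr1 subn0 bin0 mulr1n mulrDl raddfD /= mulr_suml
  raddf_sum.
rewrite big1 ?addr0 // => i _ /=; rewrite mulrnAl raddfMn /= scalar_mxX.
rewrite -[_ * (_)%:M]/(_ *m _) mul_mx_scalar -[_ * _]/(_ *m _) -scalemxAl.
rewrite mxtraceZ -[_ *m _]/(_ * _) tr_normal_l ?mulr0 ?mul0rn //.
have p_gt1 := prime_gt1 pp; rewrite /bump /= add1n subnS.
by rewrite prednK ?subn_gt0 // (leq_ltn_trans (leq_subr _ _)) // prednK // ltnW.
Qed.

Lemma tr_shift_r c :
  \tr (X ^+ p.-1 * (Y + c%:M) ^+ p.-1) = \tr (X ^+ p.-1 * Y ^+ p.-1).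
Proof.
rewrite exprDn_comm; last by apply/esym; exact: comm_scalar_mx.
rewrite big_ord_recl expr0 mulr1 subn0 bin0 mulr1n mulrDr raddfD /= mulr_sumr
  raddf_sum.
rewrite big1 ?addr0 // => i _ /=; rewrite mulrnAr raddfMn /= scalar_mxX.
rewrite -[_ * (_)%:M]/(_ *m _) mul_mx_scalar -[_ * _]/(_ *m _) -scalemxAr.
rewrite mxtraceZ -[_ *m _]/(_ * _) tr_normal_r ?mulr0 ?mul0rn //.
have p_gt1 := prime_gt1 pp; rewrite /bump /= add1n subnS.
by rewrite prednK ?subn_gt0 // (leq_ltn_trans (leq_subr _ _)) // prednK // ltnW.
Qed.

Lemma tr_eulerXn i : (i.+1 < p)%N -> \tr ((X * Y) ^+ i) = 0.
Proof.
(* The factor $X^aY^a$ strengthens the induction: multiplying it by $XY$ produces such terms for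
   $a+1$ and $a$ ([euler_normal]), so only normally ordered monomials remain. *)
suff H a : (i + a.+1 < p)%N -> \tr ((X * Y) ^+ i * (X ^+ a * Y ^+ a)) = 0.
  by move=> ip; have := H 0; rewrite !mulr1 addn1; exact.
elim: i a => [|i IH] a h; first by rewrite mul1r tr_normal_l.
rewrite exprSr -mulrA euler_normal mulrDr raddfD mulrnAr raddfMn /=.
have h1 : (i + a.+2 < p)%N by rewrite -addSnnS.
by rewrite !IH ?add0r ?mul0rn // ltnW // -addnS.
Qed.

Hypotheses (X_inv : invertible X) (Y_inv : invertible Y).
Lemma euler_conj : exists Xi, [/\ X * Xi = 1, Xi * X = 1 &
  Xi * (X * Y) * X = X * Y + 1].
Proof.
have [Xi [XXi XiX]] := X_inv; exists Xi; split=> //.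
by rewrite mulrA XiX mul1r weylE.
Qed.

(** Conjugation by a power of $X$, or of its inverse when [z] is negative. All integer translates of
    $\theta=XY$ thus share traces of powers and determinants. *)
Lemma euler_shift (z : int) :
  exists U V, [/\ U * V = 1, V * U = 1 & V * (X * Y) * U = (X * Y) + z%:~R].
Proof.
have [Xi [XXi XiX c]] := euler_conj.
have nat_shift n : exists U V, [/\ U * V = 1, V * U = 1 & V * (X * Y) * U = (X
  * Y) + n%:R].
  elim: n => [|n [U [V [UV VU e]]]].
    by exists 1, 1; rewrite !mulr1 mul1r addr0.
  exists (U * X), (Xi * V); split.
  - by rewrite mulrA -[U * _ * _]mulrA XXi mulr1.
  - by rewrite mulrA -[Xi * _ * _]mulrA VU mulr1.
  have -> : Xi * V * (X * Y) * (U * X) = Xi * (V * (X * Y) * U) * X by rewrite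
    !mulrA.
  rewrite e (mulrDr Xi (X * Y)) (mulrDl (Xi * (X * Y))) c commr_nat -(mulrA
    n%:R) XiX mulr1 -addrA.
  by rewrite [1 + _]addrC natr1.
case: z => n; first exact: nat_shift.
have [U [V [UV VU e]]] := nat_shift n.+1; exists V, U; split=> //.
have {1}-> : X * Y = V * (X * Y) * U - n.+1%:R by rewrite e addrK.
rewrite mulrBr mulrBl commr_nat -(mulrA n.+1%:R) UV mulr1 !mulrA UV mul1r.
by rewrite -(mulrA (X * Y)) UV mulr1 NegzE mulrNz -pmulrn.
Qed.

Variable w : A.
Hypothesis (Xp_Yp : X ^+ p * Y ^+ p = w%:M).

(* w theta^-1 = X^p Y^p (X Y)^-1 is conjugate by X to X^(p-1) Y^(p-1). *)
Lemma tr_euler_inv W : X * Y * W = 1 -> W * (X * Y) = 1 ->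
  w * \tr W = \tr (X ^+ p.-1 * Y ^+ p.-1).
Proof.
move=> h1 h2; have p_gt0 := prime_gt0 pp.
have [Xi [XXi XiX]] := X_inv; have [Yi [YYi YiY]] := Y_inv.
have -> : W = Yi * Xi.
  by rewrite -[W]mulr1 -XXi -[X]mulr1 -YYi !mulrA -(mulrA W) h2 mul1r.
have -> : w * \tr (Yi * Xi) = \tr (w%:M * (Yi * Xi)).
  by rewrite -[w%:M * _]/(w%:M *m _) mul_scalar_mx mxtraceZ.
have eX : X ^+ p = X * X ^+ p.-1 by rewrite -exprS prednK.
have eY : Y ^+ p = Y ^+ p.-1 * Y by rewrite -exprSr prednK.
rewrite -Xp_Yp eX eY -!mulrA (mulrA Y) YYi mul1r.
by rewrite tr_mulC -!mulrA XiX mulr1.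
Qed.

Lemma mx_exp_inv (M N : 'M[A]_p) : M * N = 1 -> N * M = 1 ->
  forall a b, M ^+ (a + b) * N ^+ b = M ^+ a.
Proof.
move=> MN NM a b; rewrite exprD -mulrA -exprMn_comm ?MN ?expr1n ?mulr1 //.
by rewrite /GRing.comm MN NM.
Qed.

Hypothesis top : \tr (X ^+ p.-1 * Y ^+ p.-1) = -1.

(** Conjugation reduces to $z=0$, and [tr_euler_inv] with [top] gives $j=1$. Then
    $w=\theta^p-\theta$ yields
    $w\,\mathrm{tr}\,\theta^{-j-1}=\mathrm{tr}\,\theta^{p-j-1}-\mathrm{tr}\,\theta^{-j}$, whose
    first term vanishes. *)
Lemma tr_euler_inv_exp (z : int) W : ((X * Y) - z%:~R) * W = 1 -> W * ((X * Y)
  - z%:~R) = 1 ->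
  forall j, (0 < j < p)%N -> (- w) ^+ j * \tr (W ^+ j) = 1.
Proof.
move=> h1 h2 j /andP[j_gt0 jp]; have p_gt0 := prime_gt0 pp.
have [U [V [UV VU e]]] := euler_shift (- z).
rewrite rmorphN /= in e; rewrite -e in h1 h2.
(* The conjugate of [W] that inverts $\theta$ itself. *)
pose W0 := U * W * V.
set E := V * (X * Y) * U in h1 h2.
have eT : X * Y = U * E * V.
  by rewrite /E !mulrA UV mul1r -(mulrA _ U) UV mulr1.
move: E eT h1 h2 {e} => E eT h1 h2.
have T1 : X * Y * W0 = 1.
  rewrite eT /W0 !mulrA -(mulrA (U * E)) VU mulr1 -(mulrA U) h1 mulr1.
  exact: UV.
have T2 : W0 * (X * Y) = 1.
  rewrite eT /W0 !mulrA -(mulrA (U * W)) VU mulr1 -(mulrA U) h2 mulr1.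
  exact: UV.
have -> : \tr (W ^+ j) = \tr (W0 ^+ j).
  have -> : W0 ^+ j = U * W ^+ j * V.
    elim: (j) => [|i IH]; first by rewrite mulr1.
    by rewrite !exprSr IH /W0 !mulrA -(mulrA _ V U) VU mulr1.
  by rewrite -mulrA tr_mulC -mulrA VU mulr1.
elim: j j_gt0 jp => // -[_ _ _|j IH _ jp].
  by rewrite !expr1 mulNr (tr_euler_inv T1 T2) top opprK.
rewrite exprSr -mulrA; suff -> : - w * \tr (W0 ^+ j.+2) = \tr (W0 ^+ j.+1).
  by rewrite IH // ltnW.
rewrite mulNr.
have -> : w * \tr (W0 ^+ j.+2) = \tr (w%:M * W0 ^+ j.+2).
  by rewrite -[w%:M * _]/(w%:M *m _) mul_scalar_mx mxtraceZ.
(* $X^pY^p$ is the falling product of the $\theta-i$, $i<p$, which is $\theta^p-\theta$ in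
   characteristic $p$. *)
have -> : w%:M = (X * Y) ^+ p - X * Y.
  rewrite -falling_charp //; last by rewrite -[p%:R]/(1%:M *+ p) -raddfMn p0
    raddf0.
  by rewrite -(weyl_falling weyl).
have -> : (X * Y) ^+ p = (X * Y) ^+ (p - j.+2 + j.+2) by rewrite (subnK (ltnW
  jp)).
rewrite mulrBl raddfB /= (mx_exp_inv T1 T2) tr_eulerXn; last first.
  by rewrite -subSn ?subSS ?ltn_subrL // ltnW.
by rewrite sub0r opprK exprS mulrA T1 mul1r.
Qed.

End WeylTraces.

(** * Explicit traces and determinants for the matrices of $x+\xi$ and $\partial_x+\eta$ *)

Section EulerTraces.

Variables (A : comPzRingType) (p : nat) (xi eta xi' eta' : A).
Hypotheses (pp : prime p) (p0 : p%:R = 0 :> A).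
Hypotheses (xiK : xi * xi' = 1) (etaK : eta * eta' = 1).

Notation X := (mx_x p xi).
Notation Y := (mx_d p eta).
Notation theta := (X * Y).
Notation w := (xi ^+ p * eta ^+ p).

Lemma mulx_mxXnE m (i j : 'I_p) :
  (mulx_mx A p ^+ m) i j = (i == (j + m)%N :> nat)%:R.
Proof.
elim: m i j => [|m IH] i j; first by rewrite addn0 mxE.
rewrite exprS mxE; under eq_bigr => l _ do rewrite IH mxE.
have [jp|jp] := ltnP (j + m) p; last first.
  rewrite big1 => [|l _].
    by rewrite addnS ltn_eqF // (leq_trans (ltn_ord i)) // ltnW.
  by rewrite [l == _ :> nat]ltn_eqF ?mulr0 // (leq_trans (ltn_ord l)).
rewrite (bigD1 (Ordinal jp)) //= eqxx mulr1 addnS big1 ?addr0 // => l.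
by rewrite -(inj_eq val_inj) /= => /negbTE ->; rewrite mulr0.
Qed.

Lemma derx_mxXnE m (i j : 'I_p) :
  (derx_mx A p ^+ m) i j = (j ^_ m)%:R *+ ((i + m)%N == j :> nat).
Proof.
elim: m i j => [|m IH] i j; first by rewrite addn0 mxE -val_eqE.
rewrite exprSr mxE; under eq_bigr => l _ do rewrite IH mxE.
case: j => -[|j] jp /=.
  by rewrite addnS big1 // => l _; rewrite mulr0n mulr0.
rewrite (bigD1 (Ordinal (ltnW jp))) //= eqxx addnS eqSS big1 ?addr0 => [|l].
  by rewrite mulr1n mulrnAl -natrM mulnC ffactSS.
by rewrite -(inj_eq val_inj) /= eqSS => /negbTE ->; rewrite mulr0.
Qed.

(** $\partial_x^{p-1}$ kills all basis vectors but $x^{p-1}$, which it sends to $(p-1)!=-1$ by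
    Wilson; multiplication by $x^{p-1}$ brings it back to the diagonal. *)
Lemma tr_mx_top : \tr (mulx_mx A p ^+ p.-1 * derx_mx A p ^+ p.-1) = -1.
Proof.
have p_gt1 := prime_gt1 pp; have p_gt0 := prime_gt0 pp.
have wilson : (p.-1)`!%:R = -1 :> A.
  have := pp; rewrite (Wilson p_gt1) => /dvdnP [d].
  move/(congr1 (fun i => i%:R : A)); rewrite -addn1 natrD natrM p0 mulr0.
  by move/eqP; rewrite addr_eq0 => /eqP.
have hp : (p.-1 < p)%N by rewrite prednK.
rewrite /mxtrace (bigD1 (Ordinal hp)) //= big1 ?addr0 => [|i].
  rewrite mxE (bigD1 (Ordinal p_gt0)) //= big1 ?addr0 => [|l].
    by rewrite mulx_mxXnE derx_mxXnE /= eqxx ffactnn mul1r.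
  rewrite -val_eqE mulx_mxXnE /= => l0.
  by rewrite ltn_eqF ?mul0r // -[X in (X < _)%N]add0n ltn_add2r lt0n.
rewrite -val_eqE mxE /= => ip; rewrite big1 // => l _; rewrite mulx_mxXnE.
rewrite ltn_eqF ?mul0r // (@leq_trans p.-1) ?leq_addl //.
by rewrite ltn_neqAle ip -ltnS prednK /=.
Qed.

(** The two translations are removed in turn; the second removal rests on the first, so the Weyl
    relation is also checked for $x$ with $\partial_x+\eta$. *)
Lemma tr_mx_normal_top : \tr (X ^+ p.-1 * Y ^+ p.-1) = -1.
Proof.
have W := derx_mulx p0.
have cE (a : A) (N : 'M[A]_p) : a%:M * N = N * a%:M by exact: comm_scalar_mx.
rewrite /mx_x tr_shift_l //; first by rewrite tr_shift_r // tr_mx_top.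
by rewrite /mx_d mulrDl mulrDr cE opprD addrACA subrr addr0.
Qed.

Lemma mx_dinv : invertible Y.
Proof.
have p_gt0 := prime_gt0 pp.
exists (Y ^+ p.-1 * (eta' ^+ p)%:M).
have e : (eta ^+ p)%:M * (eta' ^+ p)%:M = 1 :> 'M[A]_p.
  by rewrite -scalar_mxMr -exprMn etaK expr1n.
have c : (eta' ^+ p)%:M * Y = Y * (eta' ^+ p)%:M by exact: comm_scalar_mx.
split; first by rewrite mulrA -exprS prednK // mx_dp.
by rewrite -mulrA c mulrA -exprSr prednK // mx_dp.
Qed.

(** By conjugation $z=0$; then $\theta$ is the product of triangular matrices with constant
    diagonals $\xi$ and $\eta$. *)
Lemma det_euler_shift (z : int) : \det (theta - z%:~R) = w.
Proof.
have [U [V [UV VU e]]] := euler_shift (mx_weyl xi eta p0) (mx_xinv pp p0 xiK)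
  (- z).
rewrite rmorphN /= in e; rewrite -e.
have -> : \det (V * theta * U) = \det (V * U) * \det theta.
  by rewrite -![_ * _ in LHS]/(_ *m _) !det_mulmx mulrAC.
rewrite VU det1 mul1r -[X * Y]/(X *m Y) det_mulmx; congr (_ * _).
  rewrite det_trig; last first.
    apply/is_trig_mxP => i j ij; rewrite !mxE -val_eqE.
    by rewrite !ltn_eqF ?addr0 // ltnW.
  rewrite -[p in RHS]card_ord -prodr_const; apply: eq_bigr => i _.
  by rewrite !mxE eqxx ltn_eqF // add0r.
rewrite -det_tr det_trig; last first.
  apply/is_trig_mxP => i j ij; rewrite !mxE -val_eqE /= [_.+1 == _]gtn_eqF.
    by rewrite gtn_eqF // addr0.
  by rewrite ltnW.
rewrite -[p in RHS]card_ord -prodr_const; apply: eq_bigr => i _.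
by rewrite !mxE eqxx gtn_eqF // add0r.
Qed.

End EulerTraces.

(** * Formal power series *)

Section FpsCoefficients.

Variable B : pzRingType.
Implicit Types f g : fps B.

Lemma fps_coefD f g n : (f + g) n = f n + g n.
Proof. by []. Qed.

Lemma fps_coefM f g n : (f * g) n = \sum_(i < n.+1) f i * g (n - i)%N.
Proof. by []. Qed.

Lemma fps_coef0 n : (0 : fps B) n = 0.
Proof. by case: n. Qed.

Lemma fps_coef_sum I (s : seq I) (P : pred I) (F : I -> fps B) n :
  (\sum_(i <- s | P i) F i) n = \sum_(i <- s | P i) F i n.
Proof.
by apply: (big_morph (fun f : fps B => f n)) => //; exact: fps_coef0.
Qed.

Lemma fps_coefMn f m n : (f *+ m) n = f n *+ m.
Proof. by rewrite -[m]card_ord -!sumr_const fps_coef_sum. Qed.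

Lemma fps_mul_coef0 f g : (f * g) 0%N = f 0%N * g 0%N.
Proof. by rewrite fps_coefM big_ord1. Qed.

Lemma fpsC_mul b f n : (fpsC b * f) n = b * f n.
Proof.
rewrite fps_coefM big_ord_recl /= subn0 big1 ?addr0 // => i _.
by rewrite mul0r.
Qed.

Lemma fps_expr_low f i n : f 0%N = 0 -> (n < i)%N -> (f ^+ i) n = 0.
Proof.
move=> f0; elim: i n => // i IH n; rewrite ltnS => ni.
rewrite exprS fps_coefM big_ord_recl f0 mul0r add0r big1 // => j _.
by rewrite IH ?mulr0 // (leq_trans _ ni) //= ltn_subrL (leq_ltn_trans _
  (ltn_ord j)).
Qed.

Definition fps_der f : fps B := fun n => f n.+1 *+ n.+1.

Lemma fps_derD f g : fps_der (f + g) = fps_der f + fps_der g.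
Proof. by apply/funext => n; rewrite /fps_der !fps_coefD mulrnDl. Qed.

Lemma fps_der0 : fps_der 0 = 0.
Proof. by apply/funext => n; rewrite /fps_der !fps_coef0 mul0rn. Qed.

Lemma fps_derM f g : fps_der (f * g) = fps_der f * g + f * fps_der g.
Proof.
apply/funext => n; rewrite fps_coefD /fps_der !fps_coefM.
have -> : (\sum_(i < n.+2) f i * g (n.+1 - i)%N) *+ n.+1 =
    \sum_(i < n.+2) (f i *+ i) * g (n.+1 - i)%N
    + \sum_(i < n.+2) f i * (g (n.+1 - i)%N *+ (n.+1 - i)).
  rewrite -sumrMnl -big_split /=; apply: eq_bigr => i _.
  by rewrite mulrnAl mulrnAr -mulrnDr subnKC // -ltnS.
rewrite big_ord_recl mulr0n mul0r add0r [X in _ + X]big_ord_recr /= subnn.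
rewrite mulr0n mulr0 addr0; congr (_ + _); apply: eq_bigr => i _ //.
by rewrite subSn // -ltnS.
Qed.


Lemma fps_derC b : fps_der (fpsC b) = 0.
Proof. by apply/funext => n; rewrite /fps_der fps_coef0 mul0rn. Qed.

Lemma fps_der1 : fps_der 1 = 0.
Proof. exact: fps_derC. Qed.

End FpsCoefficients.

Section FpsConstants.

Variable B : pzRingType.

Lemma fpsC_zmod : zmod_morphism (@fpsC B).
Proof. by move=> a b; apply/funext => -[|j] //; apply/esym/subrr. Qed.

Lemma fpsC_monoid : monoid_morphism (@fpsC B).
Proof.
by split=> // a b; apply/funext => -[|j]; rewrite fpsC_mul //= mulr0.
Qed.

HB.instance Definition _ := GRing.isZmodMorphism.Build B (fps B) _ fpsC_zmod.
HB.instance Definition _ := GRing.isMonoidMorphism.Build B (fps B) _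
  fpsC_monoid.

End FpsConstants.

Section FpsMap.

Variables (B B' : pzRingType) (phi : {rmorphism B -> B'}).

Lemma fps_map_zmod : zmod_morphism (fps_map phi).
Proof. by move=> f g; apply/funext => n; rewrite /fps_map rmorphB. Qed.

Lemma fps_map_monoid : monoid_morphism (fps_map phi).
Proof.
split=> [|f g]; apply/funext => n.
  by case: n => [|n]; rewrite /fps_map ?rmorph1 ?rmorph0.
by rewrite /fps_map !fps_coefM rmorph_sum; apply: eq_bigr => i _; rewrite
  rmorphM.
Qed.

HB.instance Definition _ := GRing.isZmodMorphism.Build (fps B) (fps B')
  (fps_map phi) fps_map_zmod.
HB.instance Definition _ := GRing.isMonoidMorphism.Build (fps B) (fps B')
  (fps_map phi) fps_map_monoid.

Lemma fps_mapC b : fps_map phi (fpsC b) = fpsC (phi b).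
Proof. by apply/funext => -[|n]; rewrite /fps_map //= rmorph0. Qed.

End FpsMap.

Definition fps_const_coef (B : pzRingType) (f : fps B) : B := f 0%N.

Lemma fps_const_coef_zmod (B : pzRingType) : zmod_morphism (@fps_const_coef B).
Proof. by []. Qed.

Lemma fps_const_coef_monoid (B : pzRingType) :
  monoid_morphism (@fps_const_coef B).
Proof. by split=> // f g; exact: fps_mul_coef0. Qed.

HB.instance Definition _ (B : pzRingType) :=
  GRing.isZmodMorphism.Build (fps B) B _ (@fps_const_coef_zmod B).
HB.instance Definition _ (B : pzRingType) :=
  GRing.isMonoidMorphism.Build (fps B) B _ (@fps_const_coef_monoid B).

Section FpsMatrix.

Variables (B : pzRingType) (m : nat).
Implicit Types f g : fps 'M[B]_m.

Lemma fps_mx_zmod : zmod_morphism (@fps_mx B m).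
Proof.
move=> f g; apply/matrixP => i j; rewrite !mxE; apply/funext => n.
by rewrite fps_coefD /= !mxE.
Qed.

Lemma fps_mx_monoid : monoid_morphism (@fps_mx B m).
Proof.
split=> [|f g]; apply/matrixP => i j; rewrite !mxE; apply/funext => n.
  by case: n => [|n] /=; rewrite !mxE //; case: eqP.
rewrite fps_coef_sum fps_coefM summxE.
under [RHS]eq_bigr do rewrite !mxE fps_coefM.
rewrite exchange_big /=; apply: eq_bigr => l _.
by rewrite mxE; apply: eq_bigr => i' _.
Qed.

HB.instance Definition _ := GRing.isZmodMorphism.Build (fps 'M[B]_m) 'M[fps B]_m
  (@fps_mx B m) fps_mx_zmod.
HB.instance Definition _ :=
  GRing.isMonoidMorphism.Build (fps 'M[B]_m) 'M[fps B]_m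
    (@fps_mx B m) fps_mx_monoid.

Lemma tr_fps_mx f n : (\tr (fps_mx f)) n = \tr (f n).
Proof. by rewrite /mxtrace fps_coef_sum; apply: eq_bigr => i _; rewrite mxE.
  Qed.

Lemma map_fps_der_mx f : map_mx (@fps_der B) (fps_mx f) = fps_mx (fps_der f).
Proof.
apply/matrixP => i j; rewrite !mxE; apply/funext => n.
by rewrite /fps_der mulmxnE.
Qed.

Lemma map_fpsC_mx (M : 'M[B]_m) : fps_mx (fpsC M) = map_mx (@fpsC B) M.
Proof.
by apply/matrixP => i j; rewrite !mxE; apply/funext => -[|n] //=; rewrite mxE.
Qed.

End FpsMatrix.

(** * Jacobi's formula and the differential equation of $\det(1+F)$ *)

Section Jacobi.

Variables (B : comPzRingType) (d : B -> B).
Hypotheses (d1 : d 1 = 0) (d0 : d 0 = 0) (dD : {morph d : a b / a + b}).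
Hypothesis (dM : forall a b, d (a * b) = d a * b + a * d b).

Lemma derivation_sign s : d ((-1) ^+ s) = 0.
Proof.
have dN1 : d (-1) = 0 by rewrite -[LHS]add0r -{1}d1 -dD subrr d0.
by elim: s => // s IH; rewrite exprS dM IH dN1 mul0r mulr0 addr0.
Qed.

Lemma derivation_prod (I : finType) (F : I -> B) :
  d (\prod_i F i) = \sum_i d (F i) * \prod_(j | j != i) F j.
Proof.
have H (s : seq I) : uniq s ->
    d (\prod_(i <- s) F i) = \sum_(i <- s) d (F i) * \prod_(j <- s | j != i) F
      j.
  elim: s => [|a s IH] /=; first by rewrite !big_nil.
  move=> /andP[aS us]; rewrite !big_cons dM IH // eqxx mulr_sumr; congr (_ * _
    + _).
    rewrite big_seq [RHS]big_seq_cond; apply: eq_bigl => i.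
    by case: (boolP (i \in s)) => //= iS; apply/esym; apply: contraNneq aS =>
      <-.
  rewrite big_seq [RHS]big_seq; apply: eq_bigr => i iS.
  have ai : a != i by apply: contraNneq aS => ->.
  by rewrite big_cons ai mulrCA.
exact: (H _ (index_enum_uniq I)).
Qed.

(** The Leibniz expansion is differentiated one row at a time; expanding the [i]-th resulting
    determinant along its row [i] leaves the cofactors of [M]. *)
Lemma derivation_det m (M : 'M[B]_m) :
  d (\det M) = \tr (\adj M *m map_mx d M).
Proof.
pose N i : 'M[B]_m := \matrix_(i', j) if i' == i then d (M i j) else M i' j.
have -> : d (\det M) = \sum_i \det (N i).
  rewrite /determinant (big_morph _ dD d0) exchange_big /=; apply: eq_bigr => s
    _.
  rewrite dM derivation_sign mul0r add0r derivation_prod mulr_sumr.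
  apply: eq_bigr => i _; congr (_ * _); rewrite [RHS](bigD1 i) //= mxE eqxx.
  by congr (_ * _); apply: eq_bigr => j /negbTE ji; rewrite mxE ji.
rewrite mxtrace_mulC; apply: eq_bigr => i _.
rewrite (expand_det_row _ i) mxE; apply: eq_bigr => j _.
rewrite !mxE eqxx; congr (_ * (_ * \det _)).
by apply/matrixP => a b; rewrite !mxE eq_sym (negbTE (neq_lift _ _)).
Qed.

End Jacobi.

Section DetOneAdd.

Variables (A : comPzRingType) (m : nat) (f : fps 'M[A]_m).
Hypothesis f0 : f 0%N = 0.

Notation F := (fps_mx f).

Lemma det_one_add_coef0 : (\det (1 + F)) 0%N = 1.
Proof.
rewrite -[LHS]/(fps_const_coef _) -det_map_mx.
have -> : map_mx (@fps_const_coef A) (1 + F) = 1%:M; last exact: det1.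
apply/matrixP => i j; rewrite !mxE rmorphD /= rmorphMn rmorph1 /=.
by rewrite /fps_const_coef f0 mxE addr0.
Qed.

(** The product rule gives $h+1$ terms, all equal under the trace by cyclicity. *)
Lemma tr_fps_der_exp h l :
  \tr ((f ^+ h.+1) l.+1) *+ l.+1 = \tr ((f ^+ h * fps_der f) l) *+ h.+1.
Proof.
have trC (g g' : fps 'M[A]_m) i : \tr ((g * g') i) = \tr ((g' * g) i).
  by rewrite -!tr_fps_mx !rmorphM /= mxtrace_mulC.
(* The extra factor $f^b$ collects the factors that cyclicity carries past the derivative. *)
have H a b : \tr ((fps_der (f ^+ a.+1) * f ^+ b) l) =
    \tr ((f ^+ (a + b) * fps_der f) l) *+ a.+1.
  elim: a b => [|a IH] b; first by rewrite expr1 trC add0n.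
  rewrite exprSr fps_derM mulrDl fps_coefD raddfD /= -mulrA -exprS IH.
  by rewrite -addSnnS [_ *+ a.+2]mulrSr; congr (_ + _); rewrite trC mulrA
    -exprD addnC.
by rewrite -raddfMn /= -[_ *+ l.+1]/(fps_der _ l) -[fps_der _]mulr1 (H h 0)
  addn0.
Qed.

(** With $\delta=\det(1+F)$ this is the coefficient of $t^l$ in
    $\delta'=\delta\,\mathrm{tr}((1+F)^{-1}F')$, with the inverse expanded as a geometric series; no
    integer is inverted. *)
Lemma det_one_add_ode l :
  (\det (1 + F)) l.+1 *+ l.+1 =
  \sum_(i < l.+1) (\det (1 + F)) (l - i)%N *
    \sum_(h < l.+1) (-1) ^+ h * \tr ((f ^+ h * fps_der f) i).
Proof.
set a := \det (1 + F).
rewrite -[LHS]/(fps_der a l) derivation_det; last first.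
- exact: fps_derM.
- exact: fps_derD.
- exact: fps_der0.
- exact: fps_der1.
have -> : map_mx (@fps_der A) (1 + F) = fps_mx (fps_der f).
  rewrite -map_fps_der_mx; apply/matrixP => i j; rewrite !mxE fps_derD.
  by case: (i == j); rewrite /= ?mulr1n ?mulr0n ?fps_der1 ?fps_der0 add0r.
(* Powers of $f$ above the [l]-th do not reach degree [l], so a finite geometric sum is enough. *)
pose H := \sum_(h < l.+1) (- f) ^+ h.
have MH : (1 + F) * fps_mx H + fps_mx ((- f) ^+ l.+1) = 1.
  rewrite -(rmorph1 (@fps_mx A m)) -!rmorphD -rmorphM -rmorphD /=; congr fps_mx.
  have -> : 1 + f = - (- f - 1) by rewrite opprB opprK.
  by rewrite mulNr -subrX1 opprB subrK.
(* Multiplying [MH] by the adjugate avoids an inverse of $1+F$. *)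
have -> : \adj (1 + F) = a *: fps_mx H + \adj (1 + F) *m fps_mx ((- f) ^+ l.+1).
  have := congr1 (mulmx (\adj (1 + F))) MH; rewrite mulmx1 => {1}<-.
  by rewrite mulmxDr -[(1 + F) * _]/(_ *m _) mulmxA mul_adj_mx mul_scalar_mx.
rewrite mulmxDl -scalemxAl raddfD /= mxtraceZ fps_coefD.
rewrite -mulmxA [X in _ + X]fps_coef_sum.
(* The error term has order greater than [l] and does not affect the coefficient of index [l]. *)
have low i j n : (n <= l)%N -> (fps_mx ((- f) ^+ l.+1)) i j n = 0.
  move=> nl; rewrite !mxE fps_expr_low ?mxE // -[LHS]/(- f 0%N) f0.
  by rewrite oppr0.
have low' i j n : (n <= l)%N ->
    (fps_mx ((- f) ^+ l.+1) *m fps_mx (fps_der f)) i j n = 0.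
  move=> nl; rewrite mxE; etransitivity; first exact: fps_coef_sum.
  rewrite big1 // => j' _; rewrite fps_coefM big1 // => n' _.
  by rewrite low ?mul0r // (leq_trans _ nl) // -ltnS.
rewrite [X in _ + X]big1 ?addr0 => [|i _]; last first.
  rewrite mxE; etransitivity; first exact: fps_coef_sum.
  rewrite big1 // => j _; rewrite fps_coefM big1 // => n _.
  by rewrite low' ?mulr0 // leq_subr.
rewrite mulrC fps_coefM.
apply: eq_bigr => i _; rewrite mulrC; congr (_ * _).
rewrite -[_ *m _]/(_ * _) -rmorphM tr_fps_mx /= mulr_suml fps_coef_sum
  raddf_sum.
apply: eq_bigr => h _ /=; rewrite (exprNn f) -mulrA.
rewrite -signr_odd -[(-1) ^+ h]signr_odd.
case: (odd h); rewrite ?expr1 ?expr0 ?mul1r ?mulN1r //.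
by rewrite -raddfN.
Qed.

End DetOneAdd.

Lemma det_fps_mx_factor (A : comPzRingType) m (M : 'M[A]_m) (f : fps 'M[A]_m) :
  \det (fps_mx (fpsC M * (1 + f))) = fpsC (\det M) * \det (1 + fps_mx f).
Proof.
rewrite rmorphM /= -[_ * fps_mx _]/(_ *m _) det_mulmx map_fpsC_mx det_map_mx.
by rewrite rmorphD rmorph1.
Qed.

(** * The differential equation of the exponential *)

Section ExpOde.

Variables (F : fieldType) (f : fps F).
Hypotheses (charF : [pchar F] =i pred0) (f0 : f 0%N = 0).

(** This is $E'=Ef'$ for $E=\exp f$, as a recurrence of the same shape as [det_one_add_ode]. *)
Lemma fps_exp_ode l :
  fps_exp f l.+1 *+ l.+1 = \sum_(i < l.+1) fps_exp f (l - i)%N * fps_der f i.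
Proof.
(* As $f^i$ starts in degree $i$, the summation bound may be raised, which gives all coefficients a
   common one. *)
have expE n K : (n < K)%N ->
    fps_exp f n = \sum_(0 <= i < K) (i`!)%:R^-1 * (f ^+ i) n.
  move=> h; rewrite [RHS](@big_cat_nat _ _ _ n.+1) //= [X in _ + X]big_nat_cond.
  rewrite [X in _ + X]big1 ?addr0 // => i /andP[/andP[ni _] _].
  by rewrite fps_expr_low ?mulr0.
have derX i : fps_der (f ^+ i) = f ^+ i.-1 * fps_der f *+ i.
  elim: i => [|i IH]; first by rewrite fps_der1.
  rewrite exprS fps_derM IH /= mulrnAr mulrCA mulrA -exprSr mulrC mulrS.
  by case: i {IH} => // i; rewrite exprS -mulrA [f * _]mulrC.
rewrite (expE _ l.+2) // big_nat_recl // mulrnDl {1}expr0 [(1 : fps F) _]/=.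
rewrite mulr0 mul0rn add0r.
transitivity (\sum_(0 <= j < l.+1) (j`!)%:R^-1 * (fps_der f * f ^+ j) l).
  rewrite -sumrMnl; apply: eq_bigr => j _; rewrite -mulrnAr.
  rewrite -[_ l.+1 *+ _]/(fps_der _ l).
  rewrite derX fps_coefMn /= [fps_der f * _]mulrC factS natrM invfM.
  move: ((f ^+ j * fps_der f) l) => x; rewrite -(mulr_natl x).
  rewrite mulrA [_ / _ * _]mulrAC mulVf ?mul1r //.
  by have /pcharf0P -> := charF.
under [LHS]eq_bigr do rewrite fps_coefM mulr_sumr.
rewrite big_mkord exchange_big /=; apply: eq_bigr => i _.
rewrite (expE _ l.+1) ?ltnS ?leq_subr // big_mkord mulr_suml.
by apply: eq_bigr => j _; rewrite -mulrA [fps_der f i * _]mulrC.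
Qed.

End ExpOde.

(** * A spanning set of Diffbar *)

Section DiffbarSpan.

Variables (R : comNzRingType) (n : nat) (r : 'I_n -> R).

Local Notation theta := (dx r * dd r).

(** The power $x^{a-b}$; two natural exponents replace an integer one, since [x] is inverted by
    [tsinv] only. *)
Definition dxpow a b : Diffbar r := dx r ^+ a * tsinv (dx r) ^+ b.
(** The scalars $c$ for which an inverse of $\theta-c$ was adjoined. *)
Definition pole (c : R) := exists i (m : int), c = r i - m%:~R.
Definition resolvent (c : R) : Diffbar r := tsinv (theta - dconst r c).

Lemma pole_shift c (z : int) : pole c -> pole (c + z%:~R).
Proof.
by move=> [i [m ->]]; exists i, (m - z); rewrite rmorphB opprB addrA addrAC.
Qed.

Lemma resolventK c : pole c -> (theta - dconst r c) * resolvent c = 1 /\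
  resolvent c * (theta - dconst r c) = 1.
Proof.
move=> [i [m ->]]; apply: tsinvP.
by rewrite rmorphB /= rmorph_int opprB addrA addrAC; exact: dtheta_inv.
Qed.

(** Scalars being central, this says $[\theta,D]=sD$. *)
Definition has_weight (s : R) (D : Diffbar r) :=
  theta * D = D * (theta + dconst r s).

Lemma has_weightM s s' D D' :
  has_weight s D -> has_weight s' D' -> has_weight (s + s') (D * D').
Proof.
rewrite /has_weight => h h'.
by rewrite mulrA h -mulrA mulrDl h' dconst_comm -mulrDr mulrA -addrA -rmorphD
           [s' + s]addrC.
Qed.

Lemma has_weight_exp s D a : has_weight s D -> has_weight (s *+ a) (D ^+ a).
Proof.
move=> h; elim: a => [|a IH].
  by rewrite /has_weight rmorph0 addr0 mulr1 mul1r.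
by rewrite exprS mulrS; exact: has_weightM.
Qed.

Lemma has_weight_x : has_weight 1 (dx r).
Proof.
have e : dd r * dx r = theta + 1 by rewrite -(dweyl r) addrC subrK.
by rewrite /has_weight rmorph1 -e mulrA.
Qed.

Lemma has_weight_xi : has_weight (- 1) (tsinv (dx r)).
Proof.
have [xxi xix] := tsinvP (dx_inv r).
have := has_weight_x; rewrite /has_weight rmorphN rmorph1 mulrDr mulr1.
move/(congr1 (fun D => tsinv (dx r) * D * tsinv (dx r))).
rewrite mulrDr mulrDl [X in X * tsinv _ + _]mulrA xix !mul1r.
by rewrite -mulrA -[X in _ * X]mulrA xxi mulr1 mulrBr mulr1 => ->; rewrite
  addrK.
Qed.

Lemma has_weight_dxpow a b : has_weight (a%:R - b%:R) (dxpow a b).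
Proof.
have := has_weightM (has_weight_exp a has_weight_x) (has_weight_exp b
  has_weight_xi).
by rewrite mulNrn.
Qed.

Lemma resolvent_dxpow c a b : pole c ->
  resolvent c * dxpow a b = dxpow a b * resolvent (c - (a%:R - b%:R)).
Proof.
move=> cP.
have cP' : pole (c - (a%:R - b%:R)).
  by have := pole_shift (b%:Z - a%:Z) cP; rewrite opprB rmorphB.
have [_ h1] := resolventK cP; have [h2 _] := resolventK cP'.
have e : (theta - dconst r c) * dxpow a b =
    dxpow a b * (theta - dconst r (c - (a%:R - b%:R))).
  rewrite mulrBl has_weight_dxpow dconst_comm -mulrBr -addrA.
  by rewrite -rmorphB -[- dconst _ _]rmorphN opprB.
rewrite -[LHS]mulr1 -h2 mulrA -[_ * (theta - _)]mulrA -e.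
by rewrite [resolvent c * _]mulrA h1 mul1r.
Qed.

(** Division by positive integers is allowed because partial fractions divide by differences of
    poles, which are not assumed to be units of [R]. *)
Inductive dspan (S : Diffbar r -> Prop) : Diffbar r -> Prop :=
| dspan_base D : S D -> dspan S D
| dspan_add D E : dspan S D -> dspan S E -> dspan S (D + E)
| dspan_scale a D : dspan S D -> dspan S (dconst r a * D)
| dspan_div m D : (0 < m)%N -> dspan S (D *+ m) -> dspan S D.

Lemma dspan_mull S S' g : (forall D, S D -> dspan S' (g * D)) ->
  forall D, dspan S D -> dspan S' (g * D).
Proof.
move=> h D; elim=> {D}.
- exact: h.
- by move=> D E _ hD _ hE; rewrite mulrDr; exact: dspan_add.
- by move=> a D _ hD; rewrite mulrA -dconst_comm -mulrA; exact: dspan_scale.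
- by move=> m D m0 _; rewrite mulrnAr; exact: dspan_div.
Qed.

Definition weight0_basis (E : Diffbar r) :=
  (exists i, E = theta ^+ i) \/
  (exists c j, pole c /\ E = resolvent c ^+ j.+1).

Definition diffbar_basis (D : Diffbar r) :=
  exists a b E, weight0_basis E /\ D = dxpow a b * E.

Hypothesis pole_diff : forall c c', pole c -> pole c' -> c != c' ->
  exists m z, (0 < m)%N /\ m%:R = z * (c - c').

Lemma theta_weight0 E : weight0_basis E -> dspan weight0_basis (theta * E).
Proof.
case=> [[i ->]|[c [j [cP ->]]]].
  by apply: dspan_base; left; exists i.+1; rewrite exprS.
have -> : theta * resolvent c ^+ j.+1 =
    resolvent c ^+ j + dconst r c * resolvent c ^+ j.+1.
  rewrite -[X in X * _](subrK (dconst r c)) mulrDl exprS mulrA.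
  by have [-> _] := resolventK cP; rewrite mul1r.
apply: dspan_add; last first.
  by apply/dspan_scale/dspan_base; right; exists c, j.
apply: dspan_base; case: j => [|j]; first by left; exists 0%N.
by right; exists c, j.
Qed.

(** For powers of $\theta$, divide by $\theta-c$ with remainder; for powers of a resolvent at
    another pole, use the resolvent identity and induct on the exponent. *)
Lemma resolvent_weight0 c E : pole c -> weight0_basis E ->
  dspan weight0_basis (resolvent c * E).
Proof.
move=> cP; have [h1 h2] := resolventK cP.
have hc : dspan weight0_basis (resolvent c).
  by apply: dspan_base; right; exists c, 0%N.
case=> [[i ->]|[c' [j [c'P ->]]]].
  elim: i => [|i IH]; first by rewrite mulr1.
  have -> : resolvent c * theta ^+ i.+1 =
      theta ^+ i + dconst r c * (resolvent c * theta ^+ i).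
    rewrite exprS -[X in _ * (X * _)](subrK (dconst r c)) mulrDl mulrDr mulrA.
    by rewrite h2 mul1r mulrA -dconst_comm -mulrA.
  by apply: dspan_add; [apply: dspan_base; left; exists i|exact: dspan_scale].
have [<-|cc'] := eqVneq c c'.
  by rewrite -exprS; apply: dspan_base; right; exists c, j.+1.
have [m [z [m0 mz]]] := pole_diff cP c'P cc'.
have [h1' h2'] := resolventK c'P.
(* The resolvent identity, from $c-c'=(\theta-c')-(\theta-c)$. *)
have res2 : dconst r (c - c') * (resolvent c * resolvent c') =
    resolvent c - resolvent c'.
  rewrite mulrA dconst_comm -mulrA.
  have -> : dconst r (c - c') = (theta - dconst r c') - (theta - dconst r c).
    by rewrite rmorphB /= opprB [RHS]addrC addrA subrK.
  by rewrite mulrBl h1' mulrBr mulr1 mulrA h2 mul1r.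
elim: {j}j.+1 => [|j IH]; first by rewrite mulr1.
(* $c-c'$ divides the integer [m] in [R], so [res2] applies to [m] times the product. *)
apply: (dspan_div m0); rewrite -mulr_natl -(rmorph_nat (dconst r)) mz rmorphM.
rewrite -mulrA; apply: dspan_scale; rewrite exprS !mulrA -[dconst r _ * _ *
  _]mulrA.
rewrite res2 mulrBl -exprS -[_ - _](addrC (- _)) -mulN1r.
rewrite -(rmorphN1 (dconst r)); apply: dspan_add => //.
by apply/dspan_scale/dspan_base; right; exists c', j.
Qed.

Lemma xpow_mull g : (forall a b, exists a' b', g * dxpow a b = dxpow a' b') ->
  forall D, dspan diffbar_basis D -> dspan diffbar_basis (g * D).
Proof.
move=> h; apply: dspan_mull => D [a [b [E [hE ->]]]].
have [a' [b' e]] := h a b; rewrite mulrA e.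
by apply: dspan_base; exists a', b', E.
Qed.

Lemma dspan_dxpow a b E :
  dspan weight0_basis E -> dspan diffbar_basis (dxpow a b * E).
Proof.
by apply: dspan_mull => {}E hE; apply: dspan_base; exists a, b, E.
Qed.

Lemma theta_mull D : dspan diffbar_basis D -> dspan diffbar_basis (theta * D).
Proof.
apply: dspan_mull => {}D [a [b [E [hE ->]]]].
rewrite mulrA has_weight_dxpow -mulrA; apply: dspan_dxpow; rewrite mulrDl.
by apply: dspan_add; [exact: theta_weight0|apply/dspan_scale/dspan_base].
Qed.

Lemma resolvent_mull c D : pole c ->
  dspan diffbar_basis D -> dspan diffbar_basis (resolvent c * D).
Proof.
move=> cP; apply: dspan_mull => {}D [a [b [E [hE ->]]]].
rewrite mulrA resolvent_dxpow // -mulrA; apply/dspan_dxpow/resolvent_weight0 =>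
  //.
by have := pole_shift (b%:Z - a%:Z) cP; rewrite rmorphB /= -[X in c + X]opprB.
Qed.

Lemma dx_mull D : dspan diffbar_basis D -> dspan diffbar_basis (dx r * D).
Proof.
by apply: xpow_mull => a b; exists a.+1, b; rewrite /dxpow exprS mulrA.
Qed.

Lemma dxi_mull D :
  dspan diffbar_basis D -> dspan diffbar_basis (tsinv (dx r) * D).
Proof.
apply: xpow_mull => a b; exists a, b.+1; rewrite /dxpow exprS !mulrA.
congr (_ * _); apply/commrX.
by have [xxi xix] := tsinvP (dx_inv r); rewrite /GRing.comm xxi xix.
Qed.

(** Left multiplication by each generator preserves the span, hence so does that by any expression
    in them. *)
Lemma dclass_mull (u : dterm R n) D :
  dspan diffbar_basis D -> dspan diffbar_basis (dclass r u * D).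
Proof.
have [xxi xix] := tsinvP (dx_inv r).
elim: u D => [a||||i m|u hu v hv|u hu v hv] D hD.
- exact: dspan_scale.
- exact: dx_mull.
- have -> : dclass r (Txi R n) = tsinv (dx r).
    apply/esym/tsinv_uniq; rewrite -dclassM; apply/dclassP.
      exact: dcong_xxi.
    exact: dcong_xix.
  exact: dxi_mull.
(* $\partial_x=x^{-1}\theta$ reduces this generator to two cases already treated. *)
- have -> : dclass r (Td R n) = tsinv (dx r) * theta by rewrite mulrA xix mul1r.
  by rewrite -mulrA; apply/dxi_mull/theta_mull.
- have -> : dclass r (Tinv R i m) = resolvent (r i - m%:~R).
    have e : theta - dconst r (r i - m%:~R) = dclass r (Ttheta r i m).
      by rewrite /Ttheta !(dclassD, dclassM) -[dclass r (TC _ _)]/(dconst r _)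
        -rmorphN opprB.
    apply/esym/tsinv_uniq; rewrite e -dclassM; apply/dclassP.
      exact: dcong_invr.
    exact: dcong_invl.
  by apply: resolvent_mull => //; exists i, m.
- by rewrite dclassD mulrDl; apply: dspan_add; [exact: hu|exact: hv].
- by rewrite dclassM -mulrA; apply/hu/hv.
Qed.

Lemma diffbar_spanned D : dspan diffbar_basis D.
Proof.
rewrite -[D]mulr1 -[D in D * _]dreprK; apply/dclass_mull/dspan_base.
exists 0%N, 0%N, 1; split; first by left; exists 0%N.
by rewrite /dxpow !mulr1.
Qed.

End DiffbarSpan.

(** * Reduction modulo almost all primes *)

Lemma rmorph_horner_map (R B : comNzRingType) (A : pzRingType)
    (h : {rmorphism R -> B}) (f : {rmorphism B -> A}) (G : {poly R}) x :
  \sum_(i < size G) f (h G`_i) * f x ^+ i = f (map_poly h G).[x].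
Proof.
rewrite (@horner_coef_wide _ (size G)) ?size_poly // rmorph_sum /=.
by apply: eq_bigr => i _; rewrite coef_map rmorphM rmorphXn.
Qed.

Section Reduction.

Variables (R : comNzRingType) (F : fieldType) (iota : {rmorphism R -> F}).

Definition eps_at p : modp_frac R p := - (modp_xi R p ^+ p * modp_eta R p ^+ p).
Definition eval_eps p (G : {poly R}) : modp_frac R p :=
  \sum_(i < size G) modp_const p G`_i * eps_at p ^+ i.

(** A polynomial lift of [eps_at], which makes [eval_eps] a polynomial evaluation followed by a ring
    morphism. *)
Definition eps_poly p : {poly {poly R}} := - ('X%:P ^+ p * 'X ^+ p).

Lemma to_modp_fracN p (x : {poly {poly R}}) : to_modp_frac p (- x) = -
  to_modp_frac p x.
Proof.
apply: (addIr (to_modp_frac p x)).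
by rewrite addNr -(rmorphD (to_modp_frac p)) addNr; exact: rmorph0.
Qed.

Lemma eps_atE p : eps_at p = to_modp_frac p (eps_poly p).
Proof.
rewrite /eps_poly to_modp_fracN; congr (- _); apply/esym.
by etransitivity; [exact: rmorphM|congr (_ * _); exact: rmorphXn].
Qed.

Lemma eval_epsE p G : eval_eps p G =
  to_modp_frac p (map_poly (polyC \o polyC) G).[eps_poly p].
Proof.
rewrite /eval_eps eps_atE.
have h := rmorph_horner_map (polyC \o polyC) (to_modp_frac p) G (eps_poly p).
by etransitivity; [apply: eq_bigr => i _; congr (_ * _)|exact: h].
Qed.

Lemma eval_epsD p G H : eval_eps p (G + H) = eval_eps p G + eval_eps p H.
Proof. by rewrite !eval_epsE rmorphD hornerD; exact: (rmorphD (to_modp_frac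
  p)). Qed.

Lemma eval_epsM p G H : eval_eps p (G * H) = eval_eps p G * eval_eps p H.
Proof. by rewrite !eval_epsE rmorphM hornerM; exact: (rmorphM (to_modp_frac
  p)). Qed.

Lemma eval_epsC p a : eval_eps p a%:P = modp_const p a.
Proof. by rewrite eval_epsE map_polyC hornerC. Qed.

Lemma eval_epsXn p i : eval_eps p 'X^i = eps_at p ^+ i.
Proof.
by rewrite eval_epsE map_polyXn hornerXn eps_atE; exact: (rmorphXn
  (to_modp_frac p)).
Qed.

Lemma eval_eps_nat p m : eval_eps p m%:R = m%:R.
Proof. by rewrite -polyC_natr eval_epsC rmorph_nat. Qed.

(* reduction_at with data that do not depend on p. *)
Definition reduces (g : {fraction {poly F}}) (alpha : forall p, modp_frac R p)
  :=
  exists C m e (G : {poly R}), [/\ (0 < m)%N,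
    m%:R * rat_fun_var F ^+ e * g = tofrac (map_poly iota G) &
    forall p, prime p -> (C < p)%N ->
      m%:R * eps_at p ^+ e * alpha p = eval_eps p G].

Lemma reduces_ext g alpha beta C :
  (forall p, prime p -> (C < p)%N -> alpha p = beta p) ->
  reduces g alpha -> reduces g beta.
Proof.
move=> h [C' [m [e [G [m0 eg ea]]]]]; exists (maxn C C'), m, e, G; split=> // p
  pp.
by rewrite gtn_max => /andP[Cp C'p]; rewrite -h // ea.
Qed.

Lemma reducesD g h alpha beta : reduces g alpha -> reduces h beta ->
  reduces (g + h) (fun p => alpha p + beta p).
Proof.
move=> [C [m [e [G [m0 eg ea]]]]] [C' [m' [e' [G' [m0' eg' ea']]]]].
exists (maxn C C'), (m * m')%N, (e + e')%N,
  (m'%:R * 'X^e' * G + m%:R * 'X^e * G'); split; first by rewrite muln_gt0 m0.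
  rewrite !(rmorphD, rmorphM) /= -eg -eg' !rmorph_nat !map_polyXn !rmorphXn /=.
  by rewrite exprD -/(rat_fun_var F); ring.
move=> p pp; rewrite gtn_max => /andP[Cp C'p].
rewrite eval_epsD !eval_epsM !eval_epsXn !eval_eps_nat -ea // -ea' //.
by rewrite natrM exprD; ring.
Qed.

Lemma reducesM g h alpha beta : reduces g alpha -> reduces h beta ->
  reduces (g * h) (fun p => alpha p * beta p).
Proof.
move=> [C [m [e [G [m0 eg ea]]]]] [C' [m' [e' [G' [m0' eg' ea']]]]].
exists (maxn C C'), (m * m')%N, (e + e')%N, (G * G').
split; first by rewrite muln_gt0 m0.
  by rewrite !rmorphM /= -eg -eg' exprD; ring.
move=> p pp; rewrite gtn_max => /andP[Cp C'p].
by rewrite eval_epsM -ea // -ea' // natrM exprD; ring.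
Qed.

Lemma reduces_poly (G : {poly R}) :
  reduces (tofrac (map_poly iota G)) (fun p => eval_eps p G).
Proof.
by exists 0%N, 1%N, 0%N, G; split=> [//||p _ _]; rewrite expr0 !mul1r.
Qed.

Lemma reduces_const a : reduces (rat_fun_const (iota a)) (fun p => modp_const p
  a).
Proof.
have := reduces_poly a%:P; rewrite map_polyC.
by apply: (reduces_ext (C := 0%N)) => p _ _; rewrite eval_epsC.
Qed.

Lemma reduces_nat m : reduces m%:R (fun p => m%:R).
Proof.
have := reduces_const m%:R; rewrite /rat_fun_const !rmorph_nat.
by apply: (reduces_ext (C := 0%N)) => p _ _; rewrite rmorph_nat.
Qed.

Lemma reduces_sign m : reduces ((-1) ^+ m) (fun p => (-1) ^+ m).
Proof.
have := reduces_const ((-1) ^+ m).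
rewrite (rmorphXn iota) rmorphN1 (rmorphXn (@rat_fun_const F)) rmorphN1.
by apply: (reduces_ext (C := 0%N)) => p _ _; rewrite rmorphXn rmorphN1.
Qed.

Lemma reduces_eps i : reduces (rat_fun_var F ^+ i) (fun p => eps_at p ^+ i).
Proof.
have := reduces_poly 'X^i; rewrite map_polyXn rmorphXn.
by apply: (reduces_ext (C := 0%N)) => p _ _; rewrite eval_epsXn.
Qed.

Lemma reduces_eps_inv alpha C j :
  (forall p, prime p -> (C < p)%N -> eps_at p ^+ j * alpha p = 1) ->
  reduces (rat_fun_var F ^- j) alpha.
Proof.
move=> h; exists C, 1%N, j, 1; split=> // [|p pp Cp].
  by rewrite mul1r !rmorph1 divff // expf_neq0 // tofrac_eq0 polyX_eq0.
by rewrite mul1r h // -(polyC1 R) eval_epsC rmorph1.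
Qed.

Lemma reduces_sum I (s : seq I) (g : I -> {fraction {poly F}})
    (alpha : I -> forall p, modp_frac R p) :
  (forall i, reduces (g i) (alpha i)) ->
  reduces (\sum_(i <- s) g i) (fun p => \sum_(i <- s) alpha i p).
Proof.
move=> h; elim: s => [|i s IH].
  rewrite big_nil; apply: (reduces_ext (C := 0%N)) (reduces_nat 0) => p _ _.
  by rewrite big_nil.
rewrite big_cons; apply: (reduces_ext (C := 0%N)) (reducesD (h i) IH) => p _ _.
by rewrite big_cons.
Qed.

(** The factor [h] is absorbed into the denominator [m] and never inverted modulo $p$. *)
Lemma reduces_div g alpha h : (0 < h)%N ->
  reduces (h%:R * g) (fun p => h%:R * alpha p) -> reduces g alpha.
Proof.
move=> h0 [C [m [e [G [m0 eg ea]]]]]; exists C, (m * h)%N, e, G; split.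
- by rewrite muln_gt0 m0.
- by rewrite -eg natrM; ring.
- by move=> p pp Cp; rewrite -ea // natrM; ring.
Qed.

(** The free factor [m'] allows finitely many reductions to share one denominator. *)
Lemma reduces_reduction_at g alpha : reduces g alpha ->
  exists C m, (0 < m)%N /\ forall m' p, prime p -> (C < p)%N ->
    reduction_at iota (m * m') g (alpha p).
Proof.
move=> [C [m [e [G [m0 eg ea]]]]]; exists C, m; split=> // m' p pp Cp.
exists 1%N, e, (m'%:R * G); rewrite !expr1; split.
  by rewrite !rmorphM /= !rmorph_nat -eg; ring.
by rewrite -/(eval_eps p _) eval_epsM eval_eps_nat -ea // natrM -/(eps_at p);
  ring.
Qed.

End Reduction.

(** * The trace formula *)

Lemma linop_one (F : fieldType) (V : lmodType F) v : (1 : linop V) v = v.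
Proof. exact: scale1r. Qed.

Lemma linop_mulE (F : fieldType) (V : lmodType F) (f g : linop V) v :
  (f * g) v = f (g v).
Proof. by []. Qed.

Lemma linop_addE (F : fieldType) (V : lmodType F) (f g : linop V) v :
  (f + g) v = f v + g v.
Proof. by []. Qed.

Lemma linop_oppE (F : fieldType) (V : lmodType F) (f : linop V) v :
  (- f) v = - f v.
Proof. by []. Qed.

Lemma linop_exp_eigen (F : fieldType) (V : lmodType F) (f : linop V) a v i :
  f v = a *: v -> (f ^+ i) v = a ^+ i *: v.
Proof.
move=> h; elim: i => [|i IH]; first by rewrite linop_one scale1r.
by rewrite exprS linop_mulE IH linop_scale h scalerA -exprSr.
Qed.

Lemma linop_exp_eigenV (F : fieldType) (V : lmodType F) (f : linop V) a v i :
  f v = a^-1 *: v -> (f ^+ i) v = a ^- i *: v.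
Proof. by move=> h; rewrite (linop_exp_eigen i h) exprVn. Qed.

(** At index 0 the eigenvalue equation reads $e\,v_0=(e+s)v_0$. *)
Lemma weighted_shift_coef0 (F : fieldType) (e s : F) (v : {malg F[int]}) :
  s != 0 -> weighted_shift (fun m => e + m%:~R) 0 v = (e + s) *: v -> v@_0 = 0.
Proof.
move=> s0 /(congr1 (fun u => u@_0)).
rewrite weighted_shift_coef mcoeffZ subr0 addr0 mulrDl => /eqP.
by rewrite eq_sym -subr_eq0 addrC addKr mulf_eq0 (negbTE s0) => /eqP.
Qed.

Lemma T_epsD (K : closedFieldType) (f g : {fraction {poly K}}) :
  T_eps (f + g) = T_eps f + T_eps g.
Proof. by have := T_eps_linear 1 f g; rewrite rmorph1 !mul1r. Qed.

Lemma T_epsZ (K : closedFieldType) (a : K) f :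
  T_eps (rat_fun_const a * f) = rat_fun_const a * T_eps f.
Proof.
have T0 : T_eps (0 : {fraction {poly K}}) = 0.
  by apply: (addrI (T_eps 0)); rewrite -T_epsD !addr0.
by rewrite -[LHS](congr1 _ (addr0 _)) T_eps_linear T0 addr0.
Qed.


Section EpsTrace.

Variables (k : fieldType) (kb : closedFieldType) (emb : {rmorphism k -> kb}).
Variables (n : nat) (r : 'I_n -> k).

Lemma rat_fun_map_var : rat_fun_map emb (rat_fun_var k) = rat_fun_var kb.
Proof. by rewrite rat_fun_map_tofrac map_polyX. Qed.

Lemma rat_fun_map_const a :
  rat_fun_map emb (rat_fun_const a) = rat_fun_const (emb a).
Proof. by rewrite rat_fun_map_tofrac map_polyC. Qed.

Definition eps_trace (D : Diffbar r) : {fraction {poly kb}} :=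
  T_eps (rat_fun_map emb ((rho_eps r D << 0 >>)@_0)).

Lemma eps_traceD D D' : eps_trace (D + D') = eps_trace D + eps_trace D'.
Proof.
rewrite /eps_trace (rmorphD (rho_eps r)) linop_addE mcoeffD.
rewrite (rmorphD (rat_fun_map emb)); exact: T_epsD.
Qed.

Lemma eps_traceZ a D : eps_trace (dconst r a * D) = rat_fun_const (emb a) *
  eps_trace D.
Proof.
rewrite /eps_trace (rmorphM (rho_eps r)) linop_mulE rho_eps_const mcoeffZ.
rewrite (rmorphM (rat_fun_map emb)) /= rat_fun_map_const; exact: T_epsZ.
Qed.

Lemma eps_trace_sum I (s : seq I) (F : I -> Diffbar r) :
  eps_trace (\sum_(i <- s) F i) = \sum_(i <- s) eps_trace (F i).
Proof.
apply: (big_morph eps_trace eps_traceD).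
by have := eps_traceZ 0 0; rewrite mulr0 !rmorph0 mul0r.
Qed.

End EpsTrace.

Section TraceFormula.

Variables (k : fieldType) (kb : closedFieldType) (emb : {rmorphism k -> kb}).
Variables (R : comNzRingType) (iota : {rmorphism R -> k}).
Hypotheses (char_k : [pchar k] =i pred0) (iota_inj : injective iota).
Variables (n : nat) (r : 'I_n -> R) (num den : 'I_n -> int).
Hypotheses (num_den : forall i, coprimez (num i) (den i)).
Hypotheses (den0 : forall i, den i != 0).
Hypotheses (rE : forall i, (den i)%:~R * r i = (num i)%:~R).

Notation rk := (fun i => iota (r i)).
Notation E := {fraction {poly k}}.
Notation EB := {fraction {poly kb}}.
Notation theta := (dx r * dd r).

Lemma intr_char0 (F : fieldType) (z : int) : [pchar F] =i pred0 ->
  (z%:~R == 0 :> F) = (z == 0).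
Proof.
move=> /pcharf0P h; case: z => m; first by rewrite -pmulrn h.
by rewrite NegzE mulrNz oppr_eq0 -pmulrn h oppr_eq0.
Qed.

(** Multiplying $c-c'$ by the denominators of the two exponents gives an integer [z], nonzero in
    characteristic zero; its absolute value is the [m] sought. *)
Lemma pole_diff c c' : pole r c -> pole r c' -> c != c' ->
  exists m z, (0 < m)%N /\ m%:R = z * (c - c').
Proof.
move=> [i [a ->]] [j [b ->]] cc'.
pose z := den j * (num i - den i * a) - den i * (num j - den j * b).
have e : z%:~R = (den i * den j)%:~R * (r i - a%:~R - (r j - b%:~R)) :> R.
  by rewrite /z !(rmorphB, rmorphM) /= -!rE; ring.
have z0 : z != 0.
  apply: contraNneq cc' => z0; rewrite -subr_eq0 -(inj_eq iota_inj) rmorph0.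
  move: e; rewrite z0 => /(congr1 iota); rewrite rmorph0 rmorphM rmorph_int.
  move/esym/eqP; rewrite mulf_eq0 intr_char0 // mulf_eq0 !(negbTE (den0 _)).
  by [].
exists `|z|%N, ((sgz z)%:~R * (den i * den j)%:~R); split; first by rewrite
  absz_gt0.
by rewrite -mulrA -e -intrM pmulrn -abszEsg.
Qed.

Definition rho_eps_ext (D : Diffbar r) : linop {malg E[int]} :=
  rho_eps rk (diffbar_ext iota r D).

HB.instance Definition _ := GRing.RMorphism.copy rho_eps_ext
  (@rho_eps k n rk \o @diffbar_ext R k iota n r).

Notation v0 := (<< 0 >> : {malg E[int]}).

Lemma rho_eps_ext_const a v : rho_eps_ext (dconst r a) v = rat_fun_const (iota
  a) *: v.
Proof.
rewrite /rho_eps_ext /diffbar_ext diffbar_repC; last exact: diffbar_ext_axioms.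
exact: rho_eps_const.
Qed.

Lemma rho_eps_ext_theta : rho_eps_ext theta = weighted_shift (fun m =>
  rat_fun_var k + m%:~R) 0.
Proof.
rewrite rmorphM /= /rho_eps_ext /diffbar_ext diffbar_rep_x; last exact:
  diffbar_ext_axioms.
rewrite diffbar_rep_d; last exact: diffbar_ext_axioms.
rewrite /rho_eps diffbar_rep_x; last exact: rho_eps_axioms.
rewrite diffbar_rep_d; last exact: rho_eps_axioms.
by rewrite weighted_shift_mul subrr; apply: weighted_shift_eq => m; rewrite
  mul1r.
Qed.

Lemma rho_eps_ext_theta_v0 : rho_eps_ext theta v0 = rat_fun_var k *: v0.
Proof.
apply/malgP => l; rewrite rho_eps_ext_theta weighted_shift_coef subr0 mcoeffZ
  mcoeffU.
by case: eqP => [<-|_]; rewrite ?addr0 // !mulr0.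
Qed.

Lemma rho_eps_ext_theta_exp i : rho_eps_ext (theta ^+ i) v0 = rat_fun_var k ^+
  i *: v0.
Proof.
by rewrite (rmorphXn rho_eps_ext) (linop_exp_eigen _ rho_eps_ext_theta_v0).
Qed.

Lemma rho_eps_ext_resolvent c j : pole r c -> rho_eps_ext (resolvent r c ^+ j)
  v0 =
  (rat_fun_var k - rat_fun_const (iota c)) ^- j *: v0.
Proof.
move=> cP; have [_ h] := resolventK cP.
set y := _ - _; have y0 : y != 0.
  by rewrite /y /rat_fun_var /rat_fun_const -rmorphB tofrac_eq0 polyXsubC_eq0.
have e : rho_eps_ext (resolvent r c) v0 = y^-1 *: v0.
  have := congr1 (fun D => rho_eps_ext D v0) h; rewrite rmorphM rmorphB rmorph1.
  rewrite linop_mulE linop_addE linop_oppE linop_one.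
  rewrite rho_eps_ext_theta_v0 rho_eps_ext_const -scaleNr -scalerDl linop_scale.
  by move/(congr1 (fun v => y^-1 *: v)); rewrite scalerA mulVf // scale1r.
rewrite (rmorphXn rho_eps_ext).
move: y {y0} e => y e.
rewrite (linop_exp_eigenV _ e); congr (_ *: _).
Qed.

Definition coef0 (D : Diffbar r) : E := (rho_eps_ext D v0)@_0.
Definition eps_trace_ext (D : Diffbar r) : EB := eps_trace emb (diffbar_ext
  iota r D).

Lemma eps_trace_extE D : eps_trace_ext D = T_eps (rat_fun_map emb (coef0 D)).
Proof. by []. Qed.

Lemma eps_trace_extD D D' : eps_trace_ext (D + D') = eps_trace_ext D +
  eps_trace_ext D'.
Proof. by rewrite /eps_trace_ext (rmorphD (diffbar_ext iota r)) eps_traceD. Qed.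

Lemma eps_trace_extZ a D : eps_trace_ext (dconst r a * D) = rat_fun_const (emb
  (iota a)) * eps_trace_ext D.
Proof.
rewrite /eps_trace_ext (rmorphM (diffbar_ext iota r)) /=.
have -> : diffbar_ext iota r (dconst r a) = dconst rk (iota a).
  by rewrite /diffbar_ext diffbar_repC //; exact: diffbar_ext_axioms.
exact: eps_traceZ.
Qed.

Lemma eps_trace_extMn D m : eps_trace_ext (D *+ m) = m%:R * eps_trace_ext D.
Proof.
rewrite -(mulr_natl D m) -(rmorph_nat (dconst r)) eps_trace_extZ rmorph_nat
  rmorph_nat.
by rewrite (rmorph_nat (@rat_fun_const kb)).
Qed.

(** $\rho_\varepsilon(D)x^\varepsilon$ is killed by $\theta-\varepsilon-s$, whereas $x^\varepsilon$
    belongs to the eigenvalue $\varepsilon$; so its coefficient at $x^\varepsilon$ is zero. *)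
Lemma eps_trace_ext_weight (s : int) D : s != 0 -> has_weight s%:~R D ->
  eps_trace_ext D = 0.
Proof.
move=> s0 h; rewrite eps_trace_extE (_ : coef0 D = 0) ?rmorph0.
  by have := T_epsZ (0 : kb) 0; rewrite rmorph0 !mul0r.
have : rho_eps_ext theta (rho_eps_ext D v0) = (rat_fun_var k + rat_fun_const
  (iota s%:~R)) *: rho_eps_ext D v0.
  rewrite -(linop_mulE (rho_eps_ext theta)) -(rmorphM rho_eps_ext) h (rmorphM
    rho_eps_ext D) linop_mulE.
  by rewrite (rmorphD rho_eps_ext) linop_addE rho_eps_ext_theta_v0
    rho_eps_ext_const -scalerDl linop_scale.
rewrite rho_eps_ext_theta; apply: weighted_shift_coef0.
by rewrite fmorph_eq0 rmorph_int intr_char0.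
Qed.

Lemma eps_trace_ext_theta i : eps_trace_ext (theta ^+ i) = 0.
Proof.
rewrite eps_trace_extE /coef0 rho_eps_ext_theta_exp mcoeffZ mcoeffU eqxx mulr1.
by rewrite (rmorphXn (rat_fun_map emb)) /= rat_fun_map_var T_eps_poly.
Qed.

Lemma eps_trace_ext_resolvent c j : pole r c ->
  eps_trace_ext (resolvent r c ^+ j.+1) = rat_fun_var kb ^- j.+1.
Proof.
move=> cP; rewrite eps_trace_extE /coef0 rho_eps_ext_resolvent // mcoeffZ
  mcoeffU eqxx mulr1.
rewrite fmorphV (rmorphXn (rat_fun_map emb)) (rmorphB (rat_fun_map emb)) /=.
by rewrite rat_fun_map_var rat_fun_map_const T_eps_pole.
Qed.

Section ModP.

Variable p : nat.
Hypothesis pp : prime p.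

Notation A := (modp_frac R p).
Notation w := (modp_xi R p ^+ p * modp_eta R p ^+ p).
Notation X := (mx_x p (modp_xi R p)).
Notation Y := (mx_d p (modp_eta R p)).

(** [rho_p] is a morphism only given that $p$ is prime and the exponents are rational, so the
    structure is packed here instead of being a global instance. *)
Lemma rho_p_morph :
  exists phi : {rmorphism Diffbar r -> 'M[A]_p}, rho_p p r = phi.
Proof.
have ax := rho_p_axioms num_den rE pp.
pose z := GRing.isZmodMorphism.Build _ _ (rho_p p r) (diffbar_rep_zmod ax).
pose m := GRing.isMonoidMorphism.Build _ _ (rho_p p r) (diffbar_rep_monoid ax).
pose phi : {rmorphism Diffbar r -> 'M[A]_p} := HB.pack (rho_p p r) z m.
by exists phi.
Qed.

Lemma rho_p_theta : rho_p p r theta = X * Y.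
Proof.
have ax := rho_p_axioms num_den rE pp.
have [phi e] := rho_p_morph; rewrite e rmorphM -e /rho_p.
by rewrite diffbar_rep_x // diffbar_rep_d.
Qed.

Lemma rho_p_const a : rho_p p r (dconst r a) = (modp_const p a)%:M.
Proof. by rewrite /rho_p diffbar_repC //; exact: rho_p_axioms num_den rE pp.
  Qed.

Lemma rho_p_pole c : pole r c ->
  exists z : int, rho_p p r (theta - dconst r c) = X * Y - z%:~R.
Proof.
move=> [i [m ->]]; have [z e] := modp_const_int num_den rE pp i; exists (z - m).
have [phi ephi] := rho_p_morph; rewrite ephi rmorphB -ephi rho_p_theta
  rho_p_const.
have -> : modp_const p (r i - m%:~R) = (z - m)%:~R.
  by rewrite [LHS]rmorphB [RHS]rmorphB /= rmorph_int e.
by rewrite rmorph_int.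
Qed.

End ModP.

(** In the representation $s\,\mathrm{tr}\,D=\mathrm{tr}[\theta,D]=0$, and $s$ cancels modulo
    $p$. *)
Lemma tr_rho_p_weight p (s : int) D : prime p -> (0 < `|s| < p)%N ->
  has_weight s%:~R D -> \tr (rho_p p r D) = 0.
Proof.
move=> pp sp h; have [phi e] := rho_p_morph pp.
apply: (natr_cancel (modp_frac_p0 R p) pp sp).
have e0 : \tr (phi D * phi (dconst r s%:~R)) = 0.
  have e1 : \tr (phi theta * phi D) = \tr (phi D * phi (theta + dconst r
    s%:~R)).
    by rewrite -!rmorphM h.
  apply: (addrI (\tr (phi theta * phi D))).
  by rewrite addr0 [in RHS]e1 rmorphD mulrDr raddfD /= [\tr (phi theta *
    _)]tr_mulC.
move: e0; rewrite !rmorph_int mulrzr raddfMz -e mulr_natl.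
case: s {h sp} => m; first by rewrite -pmulrn.
by rewrite NegzE mulrNz -pmulrn abszN => /eqP; rewrite oppr_eq0 => /eqP.
Qed.

Lemma has_weight0_basis (F : Diffbar r) : weight0_basis F -> has_weight 0 F.
Proof.
rewrite /has_weight rmorph0 addr0 => -[[i ->]|[c [j [cP ->]]]].
  by rewrite -exprS -exprSr.
have [h1 h2] := resolventK cP.
suff h : GRing.comm theta (resolvent r c) by exact: commrX.
rewrite /GRing.comm -[X in X * _](subrK (dconst r c)) mulrDl h1.
by rewrite -[in RHS](subrK (dconst r c) theta) mulrDr h2 dconst_comm.
Qed.

(** Both sides are additive and $R$-linear, and integer factors can be divided out, so induction on
    the span leaves the products $x^{a-b}F$ with $F$ of weight 0. *)
Lemma trace_reduces D :
  reduces (emb \o iota) (eps_trace_ext D) (fun p => \tr (rho_p p r D)).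
Proof.
elim: (diffbar_spanned pole_diff D) => {D}.
- move=> _ [a [b [F [hF ->]]]]; have [ab|ab] := eqVneq a b.
    have -> : dxpow r a b * F = F.
      have [xxi xix] := tsinvP (dx_inv r).
      by rewrite ab /dxpow -exprMn_comm ?xxi ?expr1n ?mul1r // /GRing.comm xxi
        xix.
    case: hF => [[i ->]|[c [j [cP ->]]]].
      (* Both sides vanish, the trace as soon as $i+1<p$. *)
      rewrite eps_trace_ext_theta; apply: (reduces_ext (C := i.+1))
        (reduces_nat _ 0) => p pp ip.
      have [phi e] := rho_p_morph pp.
      rewrite e rmorphXn -e rho_p_theta // tr_eulerXn //.
      + exact: modp_frac_p0.
      + exact/mx_weyl/modp_frac_p0.
    rewrite eps_trace_ext_resolvent //; apply: (reduces_eps_inv _ (C := j.+1))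
      => p pp jp.
    have [phi e] := rho_p_morph pp; have [z ez] := rho_p_pole pp cP.
    have [xi' xiK] := modp_xi_unit R p; have [eta' etaK] := modp_eta_unit R p.
    have p0 := modp_frac_p0 R p.
    have [h1 h2] := resolventK cP.
    have XY : mx_x p (modp_xi R p) ^+ p * mx_d p (modp_eta R p) ^+ p =
        (modp_xi R p ^+ p * modp_eta R p ^+ p)%:M.
      by rewrite mx_xp // mx_dp // scalar_mxMr.
    have e1 : (mx_x p (modp_xi R p) * mx_d p (modp_eta R p) - z%:~R) *
        rho_p p r (resolvent r c) = 1 by rewrite -ez e -rmorphM h1 rmorph1.
    have e2 : rho_p p r (resolvent r c) *
        (mx_x p (modp_xi R p) * mx_d p (modp_eta R p) - z%:~R) = 1.
      by rewrite -ez e -rmorphM h2 rmorph1.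
    have jp' : (0 < j.+1 < p)%N by rewrite jp.
    (* Since $-w$ is the value of $\varepsilon$, this says that the trace is
       $\varepsilon^{-j-1}$. *)
    have := tr_euler_inv_exp pp p0 (mx_weyl _ _ p0) (mx_xinv pp p0 xiK)
      (mx_dinv pp p0 etaK) XY (tr_mx_normal_top _ _ pp p0) e1 e2 jp'.
    by rewrite e rmorphXn.
  have hw : has_weight (a%:Z - b%:Z)%:~R (dxpow r a b * F).
    have := has_weightM (has_weight_dxpow r a b) (has_weight0_basis hF).
    by rewrite addr0 rmorphB.
  have s0 : a%:Z - b%:Z != 0 by rewrite subr_eq0.
  rewrite (eps_trace_ext_weight s0 hw).
  (* In nonzero weight $a-b$ both sides vanish once $p>|a-b|$. *)
  apply: (reduces_ext (C := `|(a%:Z - b%:Z)%R|%N)) (reduces_nat _ 0) => p pp ip.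
  by rewrite (tr_rho_p_weight pp _ hw) // absz_gt0 s0.
- move=> D D' _ h _ h'; rewrite eps_trace_extD.
  apply: (reduces_ext (C := 0%N)) (reducesD h h') => p pp _.
  by have [phi ->] := rho_p_morph pp; rewrite rmorphD raddfD.
- move=> a D' _ h; rewrite eps_trace_extZ.
  apply: (reduces_ext (C := 0%N)) (reducesM (reduces_const _ a) h) => p pp _.
  have [phi e] := rho_p_morph pp; rewrite e rmorphM -e rho_p_const //.
  by rewrite -[_%:M * _]/(_ *m _) mul_scalar_mx mxtraceZ.
- move=> m D' m0 _; rewrite eps_trace_extMn => h; apply: (reduces_div m0).
  apply: (reduces_ext (C := 0%N)) h => p pp _.
  by have [phi e] := rho_p_morph pp; rewrite e rmorphMn raddfMn mulr_natl.
Qed.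

Lemma det_rho_p_euler_prod p : prime p ->
  \det (rho_p p r (euler_prod r)) = (modp_xi R p ^+ p * modp_eta R p ^+ p) ^+ n.
Proof.
move=> pp; have [phi e] := rho_p_morph pp.
have [xi' xiK] := modp_xi_unit R p.
have detE c : pole r c -> \det (phi (theta - dconst r c)) =
    modp_xi R p ^+ p * modp_eta R p ^+ p.
  move=> cP; have [z ez] := rho_p_pole pp cP.
  by rewrite -e ez (det_euler_shift _ pp (modp_frac_p0 R p) xiK).
rewrite e rmorph_prod (big_morph _ (@det_mulmx _ p) (det1 _ p)).
rewrite -[n in RHS]card_ord -prodr_const; apply: eq_bigr => i _.
by apply: detE; exists i, 0; rewrite subr0.
Qed.

End TraceFormula.

(** * The determinant formula *)

Section DeterminantFormula.

Variables (k : fieldType) (kb : closedFieldType) (emb : {rmorphism k -> kb}).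
Variables (R : comNzRingType) (iota : {rmorphism R -> k}).
Hypotheses (char_k : [pchar k] =i pred0) (iota_inj : injective iota).
Variables (n : nat) (r : 'I_n -> R) (num den : 'I_n -> int).
Hypotheses (num_den : forall i, coprimez (num i) (den i)).
Hypotheses (den0 : forall i, den i != 0).
Hypotheses (rE : forall i, (den i)%:~R * r i = (num i)%:~R).
Variable G : fps (Diffbar r).
Hypothesis G0 : G 0%N = 0.

Notation rk := (fun i => iota (r i)).
Notation EB := {fraction {poly kb}}.

Definition log_trace : fps EB := fun j =>
  eps_trace emb
    (fps_log1p (dconst rk) (fps_map (diffbar_ext iota r) G) j).

(** $G^{h+1}$ starts in degree $h+1$, so the terms with $h\ge j$ are zero and the bound can match
    that of [det_one_add_ode]. *)
Lemma log_traceE j m : (j <= m)%N -> log_trace j =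
  \sum_(h < m) rat_fun_const (emb ((-1) ^+ h / h.+1%:R)) *
                 eps_trace_ext emb iota ((G ^+ h.+1) j).
Proof.
move=> jm.
have -> : log_trace j = \sum_(1 <= i < j.+1)
    rat_fun_const (emb ((-1) ^+ i.+1 / i%:R)) * eps_trace_ext emb iota ((G ^+
      i) j).
  rewrite /log_trace /fps_log1p eps_trace_sum; apply: eq_bigr => i _.
  by rewrite eps_traceZ -(rmorphXn (fps_map (diffbar_ext iota r))).
rewrite big_add1 /= -(big_mkord xpredT (fun h =>
  rat_fun_const (emb ((-1) ^+ h / h.+1%:R)) * eps_trace_ext emb iota ((G ^+
    h.+1) j))).
rewrite [RHS](@big_cat_nat _ _ _ j) //= [X in _ = _ + X]big_nat_cond.
rewrite [X in _ = _ + X]big1 ?addr0 => [|i /andP[/andP[ji _] _]]; last first.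
  rewrite fps_expr_low // (_ : eps_trace_ext _ _ 0 = 0) ?mulr0 //.
  by rewrite -(mulr0n 0) eps_trace_extMn mul0r.
by apply: eq_bigr => i _; rewrite exprS mulN1r exprS mulN1r opprK.
Qed.

Definition fps_rho_p p : fps 'M[modp_frac R p]_p := fps_map (rho_p p r) G.

Lemma fps_rho_p0 p : prime p -> fps_rho_p p 0%N = 0.
Proof.
move=> pp; have [phi e] := rho_p_morph num_den rE pp.
by rewrite /fps_rho_p /fps_map G0 e rmorph0.
Qed.

Lemma fps_rho_pX p h j : prime p ->
  (fps_rho_p p ^+ h) j = rho_p p r ((G ^+ h) j).
Proof.
move=> pp; have [phi e] := rho_p_morph num_den rE pp.
by rewrite /fps_rho_p e -(rmorphXn (fps_map phi)).
Qed.

Lemma log_trace_der_reduces l i : (i <= l)%N ->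
  reduces (emb \o iota) (fps_der log_trace i)
    (fun p => \sum_(h < l.+1) (-1) ^+ h *
       \tr ((fps_rho_p p ^+ h * fps_der (fps_rho_p p)) i)).
Proof.
move=> il; rewrite /fps_der (@log_traceE _ l.+1) //.
rewrite -sumrMnl; apply: reduces_sum => h; apply: (@reduces_div _ _ _ _ _ h.+1)
  => //.
(* The factor $h+1$ clears the denominator of the logarithm; on the side of traces [tr_fps_der_exp]
   produces the same factor. *)
have -> : h.+1%:R * (rat_fun_const (emb ((-1) ^+ h / h.+1%:R)) *
      eps_trace_ext emb iota ((G ^+ h.+1) i.+1) *+ i.+1) =
    (-1) ^+ h * (i.+1%:R * eps_trace_ext emb iota ((G ^+ h.+1) i.+1)).
  have h0 : h.+1%:R != 0 :> k by have /pcharf0P -> := char_k.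
  have e : h.+1%:R * rat_fun_const (emb ((-1) ^+ h / h.+1%:R)) = (-1) ^+ h.
    rewrite -(rmorph_nat (@rat_fun_const kb \o emb)) -rmorphM mulrC divfK //.
    by rewrite rmorphXn rmorphN1.
  by rewrite mulrnAr mulrA e -mulrnAr mulr_natl.
have := reducesM (reduces_sign (emb \o iota) h)
  (reducesM (reduces_nat (emb \o iota) i.+1)
    (trace_reduces emb char_k iota_inj num_den den0 rE ((G ^+ h.+1) i.+1))).
apply: (reduces_ext (C := 0%N)) => p pp _.
rewrite -fps_rho_pX // mulr_natl tr_fps_der_exp mulrnAr.
by rewrite mulr_natl.
Qed.

(** By strong induction: determinant and exponential both start at 1, and their differential
    equations are the same recurrence, term by term under reduction. *)
Lemma det_reduces j : reduces (emb \o iota) (fps_exp log_trace j)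
  (fun p => (\det (1 + fps_mx (fps_rho_p p))) j).
Proof.
have log0 : log_trace 0%N = 0 by rewrite (@log_traceE _ 0) // big_ord0.
have char_E : [pchar EB] =i pred0.
  by move=> p; rewrite (fmorph_pchar (@rat_fun_const kb \o emb)) char_k.
elim/ltn_ind: j => -[_|l IH].
  have -> : fps_exp log_trace 0 = 1.
    by rewrite /fps_exp big_nat1 expr0 fact0 invr1 mul1r.
  have := reduces_nat (emb \o iota) 1; apply: (reduces_ext (C := 0%N)) => p pp
    _.
  by rewrite det_one_add_coef0 // fps_rho_p0.
apply: (@reduces_div _ _ _ _ _ l.+1) => //.
rewrite mulr_natl fps_exp_ode //.
have h (i : 'I_l.+1) := reducesM (IH (l - i)%N (leq_subr i l))
  (@log_trace_der_reduces l i (ltn_ord i)).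
have := reduces_sum (index_enum 'I_l.+1) h.
apply: (reduces_ext (C := 0%N)) => p pp _.
by rewrite mulr_natl det_one_add_ode // fps_rho_p0.
Qed.

End DeterminantFormula.

Theorem theorem2p2
  (k : fieldType) (char_k : [pchar k] =i pred0)
  (kb : closedFieldType) (emb : {rmorphism k -> kb})
  (kb_alg : forall z : kb, algebraicOver emb z)
  (S : subringClosed k) (R : GRing.SubComNzRing.type (S : {pred k}))
  (R_fg : fin_gen_ring R)
  (n : nat) (q : 'I_n -> rat) (r : 'I_n -> R)
  (rq : forall i, \val (r i) = ratr (q i) :> k)
  (Q : fps (Diffbar r))
  (Q0 : Q 0%N = 0)
  (Q_Diff : forall j, in_Diff (Q j))
  (N : nat) (N_gt0 : (0 < N)%N) :
  let iota : {rmorphism R -> k} := \val in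
  let rk : 'I_n -> k := fun i => iota (r i) in
  let P : Diffbar r := euler_prod r in
  let D : fps (Diffbar r) := fpsC P + Q in
  let L : fps (Diffbar rk) :=
    fps_log1p (dconst rk)
      (fps_map (diffbar_ext iota r) (fpsC (tsinv P) * Q)) in
  let coefL : fps {fraction {poly k}} :=
    fun j => (rho_eps rk (L j) << 0 >>)@_0 in
  let TL : fps {fraction {poly kb}} :=
    fun j => T_eps (rat_fun_map emb (coefL j)) in
  let rhs : fps {fraction {poly kb}} :=
    fpsC ((-1) ^+ n * rat_fun_var kb ^+ n) * fps_exp TL in
  exists C m : nat, [/\ (0 < C)%N, (0 < m)%N &
    forall p : nat, prime p -> (C < p)%N ->
      ~~ (p %| m)%N /\
      forall j : nat, (j < N)%N ->
        reduction_at (emb \o iota) m (rhs j)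
          ((\det (fps_mx (fps_map (rho_p p r) D)) : fps (modp_frac R p)) j)].
Proof.
move=> iota rk P D L coefL TL rhs.
have iota_inj : injective iota by exact: val_inj.
pose num i := numq (q i); pose den i := denq (q i).
have num_den i : coprimez (num i) (den i).
  by rewrite coprimezE; exact: coprime_num_den.
have den0 i : den i != 0 by exact: denq_neq0.
have rE i : (den i)%:~R * r i = (num i)%:~R.
  apply: iota_inj; rewrite rmorphM !rmorph_int /= [\val (r i)]rq /ratr mulrC
    divfK //.
  by rewrite intr_char0.
pose G := fpsC (tsinv P) * Q.
have G0 : G 0%N = 0 by rewrite /G fpsC_mul Q0 mulr0.
have [PPi PiP] := tsinvP (euler_prod_inv r).
have DE : D = fpsC P * (1 + G).
  rewrite mulrDr mulr1 /G mulrA; congr (_ + _).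
  apply/funext => j; rewrite -[RHS]/((fpsC P * fpsC (tsinv P) * Q) j).
  by rewrite -mulrA !fpsC_mul mulrA PPi mul1r.
have H j : reduces (emb \o iota) (rhs j)
    (fun p => (\det (fps_mx (fps_map (rho_p p r) D)) : fps (modp_frac R p)) j).
  rewrite /rhs fpsC_mul.
  have := reducesM (reducesM (reduces_sign (emb \o iota) n)
    (reduces_eps (emb \o iota) n))
    (det_reduces emb char_k iota_inj num_den den0 rE G0 j).
  apply: (reduces_ext (C := 0%N)) => p pp _.
  have [phi e] := rho_p_morph num_den rE pp.
  have -> : fps_map (rho_p p r) D = fpsC (rho_p p r P) * (1 + fps_rho_p G p).
    rewrite /fps_rho_p DE e (rmorphM (fps_map phi)) (rmorphD (fps_map phi))
      rmorph1.
    by rewrite /= fps_mapC.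
  rewrite det_fps_mx_factor fpsC_mul (det_rho_p_euler_prod num_den rE pp).
  (* With $\varepsilon=-\xi^p\eta^p$, $\det\rho_p(P)=(\xi^p\eta^p)^n=(-1)^n\varepsilon^n$. *)
  by rewrite -exprMn /eps_at mulN1r opprK.
(* One bound and one denominator for all [j < N]: the bounds are maximized and the denominators
   multiplied. *)
have [C [m [m0 hm]]] : exists C m, (0 < m)%N /\ forall m' p, prime p -> (C <
  p)%N ->
    forall j, (j < N)%N -> reduction_at (emb \o iota) (m * m') (rhs j)
      ((\det (fps_mx (fps_map (rho_p p r) D)) : fps (modp_frac R p)) j).
  elim: (N) => [|N' [C [m [m0 hm]]]]; first by exists 0%N, 1%N.
  have [C' [m1 [m1_gt0 hm1]]] := reduces_reduction_at (H N').
  exists (maxn C C'), (m * m1)%N; split=> [|m' p pp]; first by rewrite muln_gt0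
    m0.
  rewrite gtn_max => /andP[Cp C'p] j; rewrite ltnS leq_eqVlt => /orP[/eqP
    ->|jN].
    by rewrite (mulnC m) -mulnA; exact: hm1.
  by rewrite -mulnA; exact: hm.
(* Taking the bound at least [m] makes it positive and keeps $p$ from dividing [m]. *)
exists (maxn C m), m; split=> // [|p pp]; first by rewrite leq_max m0 orbT.
rewrite gtn_max => /andP[Cp mp]; split; first by rewrite gtnNdvd.
by move=> j jN; have := hm 1%N p pp Cp j jN; rewrite muln1.
Qed.
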